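(* Let $\zeta$ be a primitive aperiodic substitution on the two-letter alphabet $\{0,1\}$ whose substitution matrix has second eigenvalue $\theta_2$, let $t_0,t_1>0$ be tile lengths, and let $(X_{\mathcal T},T_g)$ be the associated tiling $\mathbb R$-action. If $|\theta_2|\neq 1$, then $(X_{\mathcal T},T_g)$ is topologically mixing if and only if it is weak mixing.
   Context: Substitutions. A substitution on a finite alphabet $\mathcal A$ is a map $\zeta$ from $\mathcal A$ to the set of nonempty finite words over $\mathcal A$, extended to words and sequences by concatenation. $\ell_i(W)$ is the number of occurrences of the letter $i$ in a word $W$. The substitution matrix is $M=(m_{i,j})$ with $m_{i,j}=\ell_i(\zeta(j))$. $\zeta$ is primitive if some power $M^k$ has all entries strictly positive. $X_\zeta\subset\mathcal A^{\mathbb Z}$ is the set of all two-sided sequences every finite subword of which occurs in $\zeta^k(i)$ for $k$ sufficiently large. $\zeta$ is aperiodic if $X_\zeta$ is infinite. The allowed words are the finite words occurring in elements of $X_\zeta$. For a two-letter alphabet, $\theta_1$ is the Perron--Frobenius eigenvalue of $M$ and $\theta_2$ is the other eigenvalue. Tilings. Given tile lengths $t_i>0$ ($i\in\mathcal A$), let the prototile $\tau_i$ be an interval of length $t_i$ labelled by $i$ (labels distinguish congruent tiles). $X_{\mathcal T}$ is the set of all tilings $\mathcal S$ of $\mathbb R$ by translates of the $\tau_i$ such that the sequence of labels along every patch (tiling of a finite interval contained in $\mathcal S$) is an allowed word of $\zeta$. The group $\mathbb R$ acts by $T_g(\mathcal S)=\mathcal S-g$. The topology on $X_{\mathcal T}$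 has as basis the sets $X_{P,\epsilon}=\{\mathcal S\in X_{\mathcal T}: \exists y\in(-\epsilon,\epsilon),\ P-y\subset\mathcal S\}$, where $P$ is a patch and $\epsilon>0$. Mixing. A continuous $\mathbb R$-action $(X,T_g)$ on a compact metrizable space is topologically mixing if for any nonempty open $U,V\subset X$ there is $R>0$ such that $U\cap T_g(V)\ne\emptyset$ for all $g\in\mathbb R$ with $|g|\ge R$. It is (topologically) weak mixing if it has no non-constant continuous eigenfunctions, where an eigenfunction is a nonzero $f:X\to\mathbb C$ for which there is $\lambda\in\mathbb R$ with $f(T_g x)=e^{2\pi i\lambda g}f(x)$ for all $x\in X$, $g\in\mathbb R$. (For these systems topological weak mixing is known to be equivalent to measure-theoretic weak mixing, so ''weak mixing'' is used without qualification.) *)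

(* Defs.v *)
From HB Require Import structures.
From mathcomp Require Import all_boot all_order all_algebra.
From mathcomp Require Import complex.
From mathcomp Require Import all_classical all_reals all_analysis.
From mathcomp Require Import lra.

Set Implicit Arguments.
Unset Strict Implicit.
Unset Printing Implicit Defensive.

Import Order.TTheory GRing.Theory Num.Theory.
Import numFieldNormedType.Exports.

Local Open Scope classical_set_scope.
Local Open Scope ring_scope.
Local Open Scope complex_scope.

Section Substitutions.
Variable n : nat.

Record substitution := Substitution {
  subst_word :> 'I_n -> seq 'I_n;
  subst_word_neq0 : forall a, subst_word a <> [::] }.

Implicit Types (zeta : substitution) (w : seq 'I_n) (x : int -> 'I_n).

Definition subst_ext zeta w : seq 'I_n := flatten [seq zeta a | a <- w].

Definition subst_iter zeta (k : nat) (a : 'I_n) : seq 'I_n :=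
  iter k (subst_ext zeta) [:: a].

Definition subst_mx zeta : 'M[nat]_n :=
  \matrix_(i < n, j < n) count_mem i (zeta j).

Definition primitive zeta : Prop :=
  exists k : nat, forall i j, (0 < (subst_mx zeta ^+ k) i j)%N.

Definition subword x (a : int) (m : nat) : seq 'I_n :=
  [seq x (a + k%:Z) | k <- iota 0 m].

(* "For k sufficiently large" is read as: for every letter i and all k large  *)
(* enough. For primitive zeta this agrees with "for some i and some k".       *)
Definition subshift zeta : set (int -> 'I_n) :=
  [set x | forall (a : int) (m : nat) (i : 'I_n),
     \forall k \near \oo, infix (subword x a m) (subst_iter zeta k i)].

Definition aperiodic zeta : Prop := infinite_set (subshift zeta).

Definition allowed zeta w : Prop :=
  exists2 x, subshift zeta x & exists a : int, w = subword x a (size w).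

End Substitutions.

Section Eigenvalues.
Variables (R : realType) (n : nat).

Definition complex_mx (M : 'M[nat]_n) : 'M[R[i]]_n := map_mx (GRing.natmul 1) M.

Definition perron_frobenius_eigenvalue (M : 'M[nat]_n) (theta : R[i]) : Prop :=
  [/\ eigenvalue (complex_mx M) theta, 0 <= theta &
      forall mu : R[i], eigenvalue (complex_mx M) mu -> `|mu| <= theta].

End Eigenvalues.

Section Tilings.
Variables (R : realType) (n : nat) (t : 'I_n -> {posnum R}).

(* (i, x) is the translate [x, x + t i] of the prototile labelled i. *)
Definition tile : Type := ('I_n * R)%type.

Implicit Types (u v : tile) (P S : set tile) (I : set R).

Definition tile_supp u : set R := `[u.2, u.2 + (t u.1)%:num]%classic.

Definition is_tiling I P : Prop :=
  \bigcup_(u in P) tile_supp u = I /\ trivIset P (fun u => (tile_supp u)°).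

Definition is_patch P : Prop :=
  exists a b : R, a < b /\ is_tiling `[a, b]%classic P.

(* Since tile lengths are bounded below, a patch is finite and so has exactly *)
(* one sequence of labels.                                                    *)
Definition patch_labels P (w : seq 'I_n) : Prop :=
  exists s : seq tile,
    [/\ [set` s] = P, sorted (fun u v => u.2 < v.2) s & w = [seq u.1 | u <- s]].

(* shift g P is P - g. *)
Definition shift (g : R) P : set tile := [set (u.1, u.2 - g) | u in P].

Lemma tile_suppE u x :
  tile_supp u x <-> u.2 <= x /\ x <= u.2 + (t u.1)%:num.
Proof.
by rewrite /tile_supp /= in_itv /=; split => [/andP[]|[-> ->]].
Qed.

Lemma tile_supp_interiorE u x :
  (tile_supp u)° x <-> u.2 < x /\ x < u.2 + (t u.1)%:num.
Proof.
by rewrite /tile_supp interior_itv /= in_itv /=; split => [/andP[]|[-> ->]].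
Qed.

Lemma shift0 P : shift 0 P = P.
Proof.
apply/seteqP; split => [_ [[i x] Px <-]|[i x] Px] /=; first by rewrite subr0.
by exists (i, x); rewrite //= subr0.
Qed.

Lemma shiftD g h P : shift g (shift h P) = shift (h + g) P.
Proof.
rewrite /shift; apply/seteqP; split => [_ [_ [u Pu <-] <-]|_ [u Pu <-]] /=.
  by exists u => //=; rewrite opprD addrA.
by exists (u.1, u.2 - h); [exists u | rewrite /= opprD addrA].
Qed.

Lemma shiftS g P S : P `<=` S -> shift g P `<=` shift g S.
Proof. by move=> PS _ [u Pu <-]; exists u => //; apply: PS. Qed.

Lemma is_tiling_shift g I P :
  is_tiling I P -> is_tiling [set x | I (x + g)] (shift g P).
Proof.
move=> [<- tP]; split.
  apply/seteqP; split => [x [_ [u Pu <-] /tile_suppE[/= h1 h2]]|x /= [u Pu]].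
    by exists u => //; apply/tile_suppE; split; lra.
  move=> /tile_suppE[h1 h2]; exists (u.1, u.2 - g); first by exists u.
  by apply/tile_suppE; split => /=; lra.
move=> _ _ [u Pu <-] [v Pv <-] [x []].
move=> /tile_supp_interiorE[/= h1 h2] /tile_supp_interiorE[/= h3 h4].
rewrite (tP u v) //; exists (x + g); split; apply/tile_supp_interiorE; split; lra.
Qed.

Lemma is_patch_shift g P : is_patch P -> is_patch (shift g P).
Proof.
move=> [a [b [ab /(is_tiling_shift g) tP]]]; exists (a - g), (b - g).
split; first lra.
suff <- : [set x | `[a, b]%classic (x + g)] = `[a - g, b - g]%classic by [].
by apply/seteqP; split => x /=; rewrite !in_itv /= lerBlDr lerBrDr.
Qed.

Lemma patch_labels_shift g P w : patch_labels P w -> patch_labels (shift g P) w.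
Proof.
move=> [s [<- ss ->]]; exists [seq (u.1, u.2 - g) | u <- s]; split.
- apply/seteqP; split => [u /mapP[v vs ->]|_ [v vs <-]]; first by exists v.
  by apply/mapP; exists v.
- rewrite sorted_map; apply: sub_sorted ss => u v /=; lra.
- by rewrite -map_comp.
Qed.

Lemma is_tiling_overlap I P u v : is_tiling I P -> P u -> P v ->
  u.2 < v.2 + (t v.1)%:num -> v.2 < u.2 + (t u.1)%:num -> u = v.
Proof.
move=> [_ tP] Pu Pv h1 h2; apply: tP => //.
have hu : 0 < (t u.1)%:num by [].
have hv : 0 < (t v.1)%:num by [].
exists ((Num.max u.2 v.2 +
         Num.min (u.2 + (t u.1)%:num) (v.2 + (t v.1)%:num)) / 2).
by split; apply/tile_supp_interiorE; case: (leP u.2 v.2) => ?;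
  case: (leP (u.2 + (t u.1)%:num) (v.2 + (t v.1)%:num)) => ?; split; lra.
Qed.

Lemma is_tiling_sub I P u : is_tiling I P -> P u -> tile_supp u `<=` I.
Proof. by move=> [<- _] Pu x ux; exists u. Qed.

Lemma is_tiling_itv_bounds a b P u : is_tiling `[a, b]%classic P -> P u ->
  a <= u.2 /\ u.2 + (t u.1)%:num <= b.
Proof.
move=> tP Pu; have su := is_tiling_sub tP Pu.
have hu : 0 < (t u.1)%:num by [].
have /su : tile_supp u u.2 by apply/tile_suppE; split; lra.
have /su : tile_supp u (u.2 + (t u.1)%:num) by apply/tile_suppE; split; lra.
by rewrite /= !in_itv /= => /andP[_ ->] /andP[->].
Qed.

Lemma is_tiling_itv_ends a b P : a < b -> is_tiling `[a, b]%classic P ->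
  (exists2 u, P u & u.2 = a) /\ (exists2 u, P u & u.2 + (t u.1)%:num = b).
Proof.
move=> ab tP; have [cP _] := tP; split.
  have : `[a, b]%classic a by rewrite /= in_itv /=; lra.
  rewrite -cP => -[u Pu /tile_suppE[h1 h2]]; exists u => //.
  by have [h3 h4] := is_tiling_itv_bounds tP Pu; lra.
have : `[a, b]%classic b by rewrite /= in_itv /=; lra.
rewrite -cP => -[u Pu /tile_suppE[h1 h2]]; exists u => //.
by have [h3 h4] := is_tiling_itv_bounds tP Pu; lra.
Qed.

Lemma is_tiling_restrict S u v : is_tiling setT S -> S u -> S v ->
  u.2 < v.2 + (t v.1)%:num ->
  is_tiling `[u.2, v.2 + (t v.1)%:num]%classic
    [set w | [/\ S w, u.2 <= w.2 & w.2 + (t w.1)%:num <= v.2 + (t v.1)%:num]].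
Proof.
move=> tS Su Sv uv; have [cS dS] := tS.
have hu : 0 < (t u.1)%:num by [].
have hv : 0 < (t v.1)%:num by [].
split; last by move=> w w' [Sw _ _] [Sw' _ _]; apply: dS.
apply/seteqP; split => [x [w [Sw h1 h2] /tile_suppE[h3 h4]]|x].
  by rewrite /= in_itv /=; lra.
rewrite /= in_itv /= => /andP[].
rewrite le_eqVlt => /predU1P[<- _|ux].
  exists u; last by apply/tile_suppE; split; lra.
  split => //; case: (leP (u.2 + (t u.1)%:num) (v.2 + (t v.1)%:num)) => // h.
  by move: (h); rewrite (is_tiling_overlap tS Su Sv uv) ?ltxx //; lra.
rewrite le_eqVlt => /predU1P[->|xv].
  exists v; last by apply/tile_suppE; split; lra.
  split => //; case: (leP u.2 v.2) => // h.
  by move: (h); rewrite (is_tiling_overlap tS Su Sv uv) ?ltxx //; lra.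
have : setT x by [].
rewrite -cS => -[w Sw /tile_suppE[h1 h2]].
exists w; last by apply/tile_suppE.
split => //.
  case: (leP u.2 w.2) => // h; move: (h).
  by rewrite (is_tiling_overlap tS Su Sw) ?ltxx //; lra.
case: (leP (w.2 + (t w.1)%:num) (v.2 + (t v.1)%:num)) => // h; move: (h).
by rewrite (is_tiling_overlap tS Sv Sw) ?ltxx //; lra.
Qed.

End Tilings.

Section TilingSpace.
Variables (R : realType) (n : nat) (zeta : substitution n).
Variable t : 'I_n -> {posnum R}.

Record tiling_space := TilingSpace {
  tiles :> set (tile R n);
  tiles_tiling : is_tiling t setT tiles;
  tiles_allowed : forall P w, P `<=` tiles -> is_patch t P ->
    patch_labels P w -> allowed zeta w }.

Implicit Type S : tiling_space.

Lemma tiling_space_ext S S' : tiles S = tiles S' -> S = S'.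
Proof.
case: S S' => [S h1 h2] [S' h1' h2'] /= SS'; subst S'.
by rewrite (Prop_irrelevance h1 h1') (Prop_irrelevance h2 h2').
Qed.

Lemma shift_tiling (g : R) S : is_tiling t setT (shift g S).
Proof. exact: (is_tiling_shift g (tiles_tiling S)). Qed.

Lemma shift_allowed (g : R) S P w : P `<=` shift g S -> is_patch t P ->
  patch_labels P w -> allowed zeta w.
Proof.
move=> /(shiftS (g := - g)); rewrite shiftD subrr shift0 => PS.
move=> /(is_patch_shift (- g)) pP /(patch_labels_shift (- g)).
exact: (tiles_allowed PS pP).
Qed.

Definition tiling_action (g : R) S : tiling_space :=
  TilingSpace (shift_tiling g S) (@shift_allowed g S).

Definition basic_open (P : set (tile R n)) (eps : R) : set tiling_space :=
  [set S | exists2 y, y \in `]- eps, eps[ & shift y P `<=` S].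

HB.instance Definition _ := gen_eqMixin tiling_space.
HB.instance Definition _ := gen_choiceMixin tiling_space.

Let basic_index : set (set (tile R n) * R) :=
  [set i | is_patch t i.1 /\ 0 < i.2].

Let basic i := basic_open i.1 i.2.

Lemma basic_open_cover : \bigcup_(i in basic_index) basic i = setT.
Proof.
apply/seteqP; split => // S _; have [cS dS] := tiles_tiling S.
have : setT (0 : R) by [].
rewrite -cS => -[u Su _]; exists ([set u], 1) => /=.
  split => //; exists u.2, (u.2 + (t u.1)%:num); split; first by rewrite ltrDl.
  by split; [rewrite bigcup_set1 | move=> v w -> ->].
exists 0; first by rewrite in_itv /=; lra.
by rewrite shift0 => _ ->.
Qed.

Lemma basic_open_join i j S : basic_index i -> basic_index j ->
  basic i S -> basic j S ->
  exists k, [/\ basic_index k, basic k S & basic k `<=` basic i `&` basic j].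
Proof.
case: i j => [P e] [P' e'] [/= pP e0] [/= pP' e0'].
move=> [y ye PS] [y' ye' PS']; move: ye ye'; rewrite !in_itv /=.
move=> /andP[y1 y2] /andP[y1' y2'].
have tS := tiles_tiling S.
have [a [b [ab tP]]] := is_patch_shift y pP.
have [a' [b' [ab' tP']]] := is_patch_shift y' pP'.
have [[u Pu ua] [v Pv vb]] := is_tiling_itv_ends ab tP.
have [[u' Pu' ua'] [v' Pv' vb']] := is_tiling_itv_ends ab' tP'.
have [p [Sp pa pa']] : exists p, [/\ tiles S p, p.2 <= a & p.2 <= a'].
  by case: (leP a a') => h; [exists u|exists u']; split; auto; lra.
have [q [Sq qb qb']] : exists q, [/\ tiles S q, b <= q.2 + (t q.1)%:num
    & b' <= q.2 + (t q.1)%:num].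
  by case: (leP b b') => h; [exists v'|exists v]; split; auto; lra.
have pq : p.2 < q.2 + (t q.1)%:num by lra.
set Q := [set w | [/\ tiles S w, p.2 <= w.2
  & w.2 + (t w.1)%:num <= q.2 + (t q.1)%:num]].
have PQ : shift y P `<=` Q.
  move=> w Pw; have [h1 h2] := is_tiling_itv_bounds tP Pw.
  by split; [exact: PS|lra|lra].
have PQ' : shift y' P' `<=` Q.
  move=> w Pw; have [h1 h2] := is_tiling_itv_bounds tP' Pw.
  by split; [exact: PS'|lra|lra].
pose d := Num.min (Num.min (e - y) (e + y)) (Num.min (e' - y') (e' + y')).
have [d0 d1 d2 d3 d4] :
    [/\ 0 < d, d <= e - y, d <= e + y, d <= e' - y' & d <= e' + y'].
  by split; rewrite /d ?lt_min ?ge_min ?lexx ?orbT //;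
    apply/andP; split; apply/andP; split; lra.
exists (Q, d); split.
- split => //=; exists p.2, (q.2 + (t q.1)%:num); split => //.
  exact: is_tiling_restrict.
- by exists 0; [rewrite in_itv /=; lra | rewrite shift0 => w []].
move=> S' [z]; rewrite in_itv /= => /andP[z1 z2] QS'; split.
  exists (y + z); first by rewrite in_itv /=; lra.
  by rewrite -shiftD; apply: subset_trans QS'; apply: shiftS.
exists (y' + z); first by rewrite in_itv /=; lra.
by rewrite -shiftD; apply: subset_trans QS'; apply: shiftS.
Qed.

HB.instance Definition _ := isBaseTopological.Build tiling_space
  basic_open_cover basic_open_join.

End TilingSpace.

Arguments tiling_action {R n} zeta t g S.

Section Mixing.
Variables (R : realType) (X : topologicalType) (T : R -> X -> X).

Definition topologically_mixing : Prop :=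
  forall U V : set X, open U -> open V -> U !=set0 -> V !=set0 ->
    exists2 r : R, 0 < r &
      forall g : R, r <= `|g| -> U `&` (T g @` V) !=set0.

(* exp (2 pi i x) *)
Definition expi (x : R) : R[i] := cos (2 * pi * x) +i* sin (2 * pi * x).

Definition eigenfunction (f : X -> R[i]) : Prop :=
  (exists x, f x != 0) /\
  exists lambda : R, forall x g, f (T g x) = expi (lambda * g) * f x.

(* R[i]^o is R[i] with the topology of its norm. *)
Definition weakly_mixing : Prop :=
  forall f : X -> R[i], continuous (f : X -> R[i]^o) -> eigenfunction f ->
    exists c : R[i], forall x, f x = c.

End Mixing.

(* Main.v *)
(** Mixing excludes a nonconstant continuous eigenfunction f of eigenvalue lambda:
along large g with lambda g an integer, T_g preserves the values of f, yet it
must bring points near x to points near y.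

For the converse let d be a left eigenvector of the substitution matrix for
theta2, so that the sum D of d over words satisfies D(zeta w) = theta2 D(w);
theta2 is real and the two entries of d have opposite signs.

If |theta2| < 1, then D is bounded on the language, and the maximum H of its
partial sums to the right of a tile is a continuous function with coboundary d
(Gottschalk-Hedlund, made explicit by the fact that every word occurs to the
right of every tile).  Choosing lambda, beta with lambda t_i + beta d_i integers
makes exp(2 pi i (- lambda x + beta H)), x the position of the tile, a
nonconstant continuous eigenfunction.  If t_0 / t_1 is rational, the same works
with beta = 0.

If |theta2| > 1, the number of zeros of words of length n takes values in an
interval whose width tends to infinity with n: were it at most B, D would be
O(B) on words of length n, too small to reach the value of order |theta2|^(k+K)
it takes on zeta^(k+K) of a letter, k being the level of length about n.  A
sliding window realizes every interior value by a word that starts with 0 and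
is followed by 1.  If t_0 / t_1 is irrational the lengths of these words are
eventually eps-dense, and so are those of their images under zeta^k, which
start with any prescribed pattern inside zeta^k(0) and are followed by any
prescribed pattern inside zeta^k(1). *)

Require Import Defs.
From mathcomp Require Import all_boot all_order all_algebra.
From mathcomp Require Import complex.
From mathcomp Require Import all_classical all_reals all_analysis.
From mathcomp Require Import zify ring lra.
Import Order.TTheory GRing.Theory Num.Theory.
Import numFieldNormedType.Exports.
Local Open Scope ring_scope.
Local Open Scope complex_scope.
Set Implicit Arguments.
Unset Strict Implicit.
Unset Printing Implicit Defensive.

(** * The language of a substitution *)

Section WordSum.
Variables (R : realType) (n : nat).
Implicit Types (d : 'I_n -> R) (w u v : seq 'I_n).

Definition word_sum d w : R := \sum_(a <- w) d a.

Lemma word_sum_nil d : word_sum d [::] = 0.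
Proof. by rewrite /word_sum big_nil. Qed.

Lemma word_sum_cons d a w : word_sum d (a :: w) = d a + word_sum d w.
Proof. by rewrite /word_sum big_cons. Qed.

Lemma word_sum_cat d u v : word_sum d (u ++ v) = word_sum d u + word_sum d v.
Proof. by rewrite /word_sum big_cat. Qed.

Lemma word_sum_norm_le d (M : R) w : (forall a, `|d a| <= M) ->
  `|word_sum d w| <= M * (size w)%:R.
Proof.
move=> dM; elim: w => [|a w IH]; first by rewrite word_sum_nil normr0 mulr0.
rewrite word_sum_cons; apply: le_trans (ler_normD _ _) _.
rewrite /= -add1n natrD mulrDr mulr1; exact: lerD.
Qed.

Lemma word_sum_bound d : exists2 M : R, 0 < M & forall a, `|d a| <= M.
Proof.
exists (1 + \sum_a `|d a|).
  by apply: ltr_pwDl => //; apply: sumr_ge0.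
move=> a; rewrite (bigD1 a) //= addrCA lerDl; apply: addr_ge0 => //.
by apply: sumr_ge0.
Qed.

End WordSum.


Section Language.
Variables (n : nat) (zeta : substitution n).
Implicit Types (w u v : seq 'I_n) (k : nat).

Definition iter_word k w := iter k (subst_ext zeta) w.

Lemma subst_ext_cat u v :
  subst_ext zeta (u ++ v) = subst_ext zeta u ++ subst_ext zeta v.
Proof. by rewrite /subst_ext map_cat flatten_cat. Qed.

Lemma subst_ext_cons a w : subst_ext zeta (a :: w) = zeta a ++ subst_ext zeta w.
Proof. by []. Qed.

Lemma iter_word_cat k u v :
  iter_word k (u ++ v) = iter_word k u ++ iter_word k v.
Proof.
by elim: k => //= k ->; rewrite subst_ext_cat.
Qed.

Lemma iter_word_cons k a w :
  iter_word k (a :: w) = subst_iter zeta k a ++ iter_word k w.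
Proof. by rewrite -cat1s iter_word_cat. Qed.

Lemma iter_word_nil k : iter_word k [::] = [::].
Proof. by elim: k => //= k ->. Qed.

Lemma iter_word1 k a : iter_word k [:: a] = subst_iter zeta k a.
Proof. by []. Qed.

Lemma subst_iterD k l a :
  subst_iter zeta (k + l) a = iter_word k (subst_iter zeta l a).
Proof. by rewrite /subst_iter iterD. Qed.

Lemma subst_iterSr k a : subst_iter zeta k.+1 a = iter_word k (zeta a).
Proof. by rewrite -addn1 subst_iterD /subst_iter /= subst_ext_cons cats0. Qed.

Lemma size_subst_word a : (0 < size (zeta a))%N.
Proof. by rewrite lt0n size_eq0; apply/eqP/subst_word_neq0. Qed.

Lemma leq_size_subst_ext w : (size w <= size (subst_ext zeta w))%N.
Proof.
elim: w => //= a w IH; rewrite subst_ext_cons size_cat -add1n.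
by apply: leq_add => //; exact: size_subst_word.
Qed.

Lemma leq_size_iter_word k w : (size w <= size (iter_word k w))%N.
Proof.
by elim: k => //= k IH; apply: leq_trans IH (leq_size_subst_ext _).
Qed.

Lemma leq_size_subst_iter k l a : (k <= l)%N ->
  (size (subst_iter zeta k a) <= size (subst_iter zeta l a))%N.
Proof.
by move=> /subnK <-; rewrite subst_iterD leq_size_iter_word.
Qed.

Lemma size_subst_iter_gt0 k a : (0 < size (subst_iter zeta k a))%N.
Proof. exact: leq_size_iter_word k [:: a]. Qed.

Lemma subst_iter_cons k a : exists b w, subst_iter zeta k a = b :: w.
Proof.
by have := size_subst_iter_gt0 k a; case: subst_iter => // b w _; exists b, w.
Qed.

Lemma infix_iter_word k u v : infix u v -> infix (iter_word k u) (iter_word k v).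
Proof.
move=> /infixP[s [s' ->]]; rewrite !iter_word_cat; exact: infix_infix.
Qed.

Lemma mem_infix_iter_word k a w :
  a \in w -> infix (subst_iter zeta k a) (iter_word k w).
Proof.
by move=> /splitPr[s s']; rewrite iter_word_cat iter_word_cons infix_infix.
Qed.

(** Phrased through iterates rather than through the subshift, which makes closure under [iter_word]
    immediate; [allowed_lang] connects it with tilings. *)
Definition lang w := exists k i, infix w (subst_iter zeta k i).

Lemma lang_infix u v : infix u v -> lang v -> lang u.
Proof. by move=> uv [k [i vk]]; exists k, i; apply: infix_trans uv vk. Qed.

Lemma lang_subst_iter k i : lang (subst_iter zeta k i).
Proof. by exists k, i; exact: infix_refl. Qed.

Lemma lang_iter_word k w : lang w -> lang (iter_word k w).
Proof.
move=> [l [i wl]]; exists (k + l)%N, i.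
by rewrite subst_iterD; exact: infix_iter_word.
Qed.

Lemma word_sum_iter_word (R : realType) (d : 'I_n -> R) k w :
  word_sum d (iter_word k w) =
  word_sum (fun a => word_sum d (subst_iter zeta k a)) w.
Proof.
elim: w => [|a w IH]; first by rewrite iter_word_nil /word_sum !big_nil.
by rewrite iter_word_cons word_sum_cat IH word_sum_cons.
Qed.

Lemma size_bound : exists2 m : nat, (0 < m)%N & forall a, (size (zeta a) <= m)%N.
Proof.
exists (1 + \sum_a size (zeta a))%N => // a.
by rewrite (bigD1 a) //= addnCA leq_addr.
Qed.

Lemma size_iter_word_le m k w : (forall a, (size (zeta a) <= m)%N) ->
  (size (iter_word k w) <= m ^ k * size w)%N.
Proof.
move=> zm.
have ext v : (size (subst_ext zeta v) <= m * size v)%N.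
  elim: v => // a v IH; rewrite subst_ext_cons size_cat /= mulnS.
  exact: leq_add.
elim: k => [|k IH] /=; first by rewrite mul1n.
by apply: leq_trans (ext _) _; rewrite expnS -mulnA leq_mul2l IH orbT.
Qed.

(** Blocks lying wholly before [v] are discarded. What remains of the block in which [v] starts has
    length at most [m], so the block after it still ends within the first [2 * m] letters of [v]. *)
Lemma infix_block k y v m : (forall a, (size (subst_iter zeta k a) <= m)%N) ->
  (2 * m <= size v)%N -> (0 < m)%N -> infix v (iter_word k y) ->
  exists a, infix (subst_iter zeta k a) v.
Proof.
move=> km vm m0 /infixP[s [s' e]].
elim: y s e => [|a y IH] s.
  rewrite iter_word_nil => /(congr1 size); rewrite !size_cat /=; lia.
rewrite iter_word_cons => e.
have [sa|as_] := leqP (size (subst_iter zeta k a)) (size s).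
  apply: (IH (drop (size (subst_iter zeta k a)) s)).
  move/(congr1 (drop (size (subst_iter zeta k a)))): e.
  rewrite (@drop_size_cat _ _ (subst_iter zeta k a)) // => ->; rewrite drop_cat.
  by case: ltngtP sa => // -> _; rewrite subnn drop0 drop_size.
have {}e : drop (size s) (subst_iter zeta k a) ++ iter_word k y = v ++ s'.
  by move/(congr1 (drop (size s))): e; rewrite (@drop_size_cat _ _ s) // drop_cat as_.
case: y IH e => [|b y] IH e.
  move/(congr1 size): e; rewrite iter_word_nil cats0 size_drop size_cat.
  by have := km a; lia.
exists b; set c := drop _ _ in e.
have cm : (size c <= m)%N by rewrite size_drop; have := km a; lia.
move: e; rewrite iter_word_cons catA => /(congr1 (take (size v))).
rewrite [RHS]take_cat ltnn subnn take0 cats0 => <-.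
rewrite take_cat size_cat ltnNge.
have -> : (size c + size (subst_iter zeta k b) <= size v)%N.
  by have := km b; lia.
by rewrite /= -catA infix_infix.
Qed.

Hypothesis zeta_prim : primitive zeta.

(** Letter counts in iterates are entries of matrix powers. Positivity at one exponent [K] passes to
    every later [k]: apply the [K]-th iterate to the first letter of the iterate of order
    [k - K]. *)
Lemma primitive_mem : exists K, forall k, (K <= k)%N ->
  forall i j, i \in subst_iter zeta k j.
Proof.
have cnt k i j : count_mem i (subst_iter zeta k j) = (subst_mx zeta ^+ k) i j.
  have ext w l : count_mem l (subst_ext zeta w) =
      (\sum_h subst_mx zeta l h * count_mem h w)%N.
    elim: w => [|a w IH] /=; first by rewrite big1 // => h _; rewrite muln0.
    rewrite subst_ext_cons count_cat IH.
    under [RHS]eq_bigr do rewrite mulnDr.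
    rewrite big_split /=; congr addn.
    rewrite (bigD1 a) //= big1 ?addn0 ?eqxx ?muln1 ?mxE //.
    by move=> h /negbTE; rewrite eq_sym => ->; rewrite muln0.
  elim: k i => [|k IH] i /=.
    by rewrite addn0 expr0 mxE eq_sym; case: eqP.
  rewrite exprS mxE /subst_iter /= ext.
  by apply: eq_bigr => h _; rewrite -IH.
have [K KP] := zeta_prim; exists K => k Kk i j.
rewrite -(subnKC Kk) subst_iterD.
have [b [w ->]] := subst_iter_cons (k - K) j.
rewrite iter_word_cons mem_cat -has_pred1 has_count.
by rewrite cnt KP.
Qed.

Lemma lang_near w : lang w ->
  exists K, forall k, (K <= k)%N -> forall j, infix w (subst_iter zeta k j).
Proof.
move=> [l [i wl]]; have [K KP] := primitive_mem.
exists (l + K)%N => k lk j; apply: infix_trans wl _.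
have -> : k = (l + (k - l))%N by lia.
rewrite subst_iterD; apply: mem_infix_iter_word.
by apply: KP; lia.
Qed.

(** Uniform recurrence: a long word contains a complete supertile of level [k], and [k] is chosen so
    that every such supertile contains [w]. *)
Lemma lang_in_long w : lang w ->
  exists M, forall v, lang v -> (M <= size v)%N -> infix w v.
Proof.
move=> /lang_near[k kw].
pose m := (1 + \sum_a size (subst_iter zeta k a))%N.
have km a : (size (subst_iter zeta k a) <= m)%N.
  by rewrite /m (bigD1 a) //= addnCA leq_addr.
exists (2 * m)%N => v lv vm.
have [_ [i _]] := lv.
have [K /(_ (k + K)%N (leq_addl _ _) i)] := lang_near lv.
rewrite subst_iterD => /(infix_block km vm isT)[a]; apply: infix_trans.
exact: kw.
Qed.

End Language.

(** * Growth of eigenvector sums over iterates *)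

Section WordSumIter.
Variables (R : realType) (n : nat) (zeta : substitution n).
Variables (d : 'I_n -> R) (theta : R).
Hypothesis d_eigen : forall a, word_sum d (zeta a) = theta * d a.
Implicit Types (w u v : seq 'I_n) (k : nat).

Lemma word_sum_iter_eigen k w :
  word_sum d (iter_word zeta k w) = theta ^+ k * word_sum d w.
Proof.
elim: k w => [|k IH] w; first by rewrite mul1r.
rewrite /iter_word iterSr -/(iter_word zeta k _) IH exprSr -mulrA; congr (_ * _).
elim: w => [|a w IHw]; first by rewrite word_sum_nil mulr0.
by rewrite subst_ext_cons word_sum_cat IHw d_eigen word_sum_cons mulrDr.
Qed.

(** A prefix consists of whole blocks and an incomplete one. With [zeta a] for [y], this reduces
    prefixes of supertiles of level [k.+1] to prefixes of supertiles of level [k]. *)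
Lemma prefix_iter_word k y w s : iter_word zeta k y = w ++ s ->
  exists y1 w', [/\ w = iter_word zeta k y1 ++ w', (size y1 <= size y)%N &
    w' = [::] \/ exists b s', subst_iter zeta k b = w' ++ s'].
Proof.
elim: y w => [|a y IH] w.
  rewrite iter_word_nil; case: w => // _.
  by exists [::], [::]; split => //; [rewrite iter_word_nil | left].
rewrite iter_word_cons => e.
have [wa|aw] := ltnP (size w) (size (subst_iter zeta k a)).
  exists [::], w; split => //; first by rewrite iter_word_nil.
  right; exists a, (drop (size w) (subst_iter zeta k a)).
  move/(congr1 (take (size w))): e.
  rewrite (@take_size_cat _ _ w) // take_cat wa => {1}<-.
  by rewrite cat_take_drop.
have [w1 ew] : exists w1, w = subst_iter zeta k a ++ w1.
  exists (drop (size (subst_iter zeta k a)) w).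
  move/(congr1 (take (size (subst_iter zeta k a)))): e.
  rewrite take_size_cat // (takel_cat _ aw) => {1}->.
  by rewrite cat_take_drop.
move: e; rewrite ew -catA => /eqP; rewrite eqseq_cat // eqxx /= => /eqP e.
have [y1 [w' [-> y1y h]]] := IH _ e.
by exists (a :: y1), w'; split => //; rewrite iter_word_cons catA.
Qed.

(** Descending from level [k.+1] to level [k] splits off the [k]-th iterate of at most [m] letters,
    whose sum is at most [M * m] times the [k]-th power of [|theta|]. *)
Lemma word_sum_prefix_geometric (M : R) (m : nat) :
  (forall a, `|d a| <= M) -> (forall a, (size (zeta a) <= m)%N) ->
  forall k a w s, subst_iter zeta k a = w ++ s ->
  `|word_sum d w| <= M * m%:R * (\sum_(j < k) `|theta| ^+ j) + M.
Proof.
move=> dM zm; elim=> [|k IH] a w s.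
  have M0 : 0 <= M by apply: le_trans (dM a).
  rewrite big_ord0 mulr0 add0r; case: w => [|b [|]] //.
    by rewrite word_sum_nil normr0.
  by case=> <- _; rewrite word_sum_cons word_sum_nil addr0.
have M0 : 0 <= M by apply: le_trans (dM a).
rewrite subst_iterSr => /prefix_iter_word[y1 [w' [-> y1a h]]].
rewrite word_sum_cat word_sum_iter_eigen big_ord_recr /=.
have h1 : `|word_sum d w'| <= M * m%:R * (\sum_(j < k) `|theta| ^+ j) + M.
  case: h => [->|[b [s' /IH//]]]; rewrite word_sum_nil normr0.
  apply: addr_ge0 => //; apply: mulr_ge0; first exact: mulr_ge0.
  by apply: sumr_ge0 => j _; exact: exprn_ge0.
have h2 : `|theta ^+ k * word_sum d y1| <= M * m%:R * `|theta| ^+ k.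
  rewrite normrM normrX mulrC; apply: ler_wpM2r; first exact: exprn_ge0.
  apply: le_trans (word_sum_norm_le y1 dM) _; apply: ler_wpM2l => //.
  by rewrite ler_nat; apply: leq_trans y1a (zm a).
by apply: le_trans (ler_normD _ _) _; lra.
Qed.

Lemma word_sum_prefix_contract : `|theta| < 1 ->
  exists2 E : R, 0 < E & forall k a w s, subst_iter zeta k a = w ++ s ->
  `|word_sum d w| <= E.
Proof.
move=> th1; have [M M0 dM] := word_sum_bound d; have [m m0 zm] := size_bound zeta.
have th1' : 0 < 1 - `|theta| by rewrite subr_gt0.
exists (M * m%:R / (1 - `|theta|) + M).
  by apply: addr_gt0 => //; rewrite !(mulr_gt0, invr_gt0) // ltr0n.
move=> k a w s e; apply: le_trans (word_sum_prefix_geometric dM zm e) _.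
rewrite lerD2r; apply: ler_wpM2l; first by apply: mulr_ge0 => //; exact: ltW.
rewrite -[leRHS]mul1r ler_pdivlMr //.
have := subrX1 `|theta| k.
have : 0 <= `|theta| ^+ k by exact: exprn_ge0.
nra.
Qed.

Lemma word_sum_prefix_expand : 1 < `|theta| ->
  exists2 E : R, 0 < E & forall k a w s, subst_iter zeta k a = w ++ s ->
  `|word_sum d w| <= E * `|theta| ^+ k.
Proof.
move=> th1; have [M M0 dM] := word_sum_bound d; have [m m0 zm] := size_bound zeta.
have th1' : 0 < `|theta| - 1 by rewrite subr_gt0.
exists (M * m%:R / (`|theta| - 1) + M).
  by apply: addr_gt0 => //; rewrite !(mulr_gt0, invr_gt0) // ltr0n.
move=> k a w s e; apply: le_trans (word_sum_prefix_geometric dM zm e) _.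
rewrite mulrDl; apply: lerD; last first.
  by apply: ler_peMr; [exact: ltW | apply: exprn_ege1; exact: ltW].
rewrite -!mulrA; apply: ler_wpM2l; first exact: ltW.
apply: ler_wpM2l => //; rewrite mulrC ler_pdivlMr //.
have := subrX1 `|theta| k; nra.
Qed.

Lemma word_sum_lang_bounded : `|theta| < 1 ->
  exists C : R, forall w, lang zeta w -> `|word_sum d w| <= C.
Proof.
move=> /word_sum_prefix_contract[E E0 EP]; exists (E + E) => w.
move=> [k [a /infixP[s [s' e]]]].
(* A factor of a supertile is the difference of two of its prefixes. *)
have -> : word_sum d w = word_sum d (s ++ w) - word_sum d s.
  by rewrite word_sum_cat addrC addKr.
apply: le_trans (ler_normB _ _) _; apply: lerD.
  by apply: (EP k a _ s'); rewrite -catA.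
exact: EP e.
Qed.

End WordSumIter.

(** * Zero counts of words of equal length *)

Lemma exists_expr_ge (R : realType) (x C : R) : 1 < x ->
  exists k, forall l, (k <= l)%N -> C <= x ^+ l.
Proof.
move=> x1; have x10 : 0 < x - 1 by rewrite subr_gt0.
have bern l : 1 + (x - 1) * l%:R <= x ^+ l.
  elim: l => [|l IH]; first by rewrite mulr0 addr0.
  have l0 : 0 <= l%:R :> R by [].
  have h1 : 0 <= (x - 1) * (x - 1) * l%:R by rewrite !mulr_ge0 // ltW.
  have x0 : 0 <= x by lra.
  by have := ler_wpM2l x0 IH; rewrite exprS -natr1; lra.
exists (Num.bound (`|C| / (x - 1))) => l kl.
apply: le_trans (bern l); apply: le_trans (ler_norm _) _.
have : `|C| / (x - 1) < l%:R.
  apply: lt_le_trans (archi_boundP _) _; last by rewrite ler_nat.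
  by rewrite divr_ge0 // ltW.
by rewrite ltr_pdivrMr // => h; lra.
Qed.

Lemma ord2P (i : 'I_2) : i = ord0 \/ i = ord_max.
Proof. by case: i => [[|[|//]]] h; [left|right]; apply: val_inj. Qed.

Section TwoLetters.
Variable zeta : substitution 2.
Hypothesis zeta_prim : primitive zeta.
Implicit Types (w u v : seq 'I_2) (k : nat).

Notation L := (lang zeta).
Notation zeros := (count_mem (ord0 : 'I_2)).

(** Some iterate of order [K] puts both letters into every image, so it at least doubles lengths. *)
Lemma exists_lang_size N : exists2 w, L w & size w = N.
Proof.
have [K /(_ K (leqnn K)) Kmem] := primitive_mem zeta_prim.
have K2 a : (2 <= size (subst_iter zeta K a))%N.
  have := Kmem ord0 a; have := Kmem ord_max a.
  by case: subst_iter => [|b [|c r]] //; rewrite !inE => /eqP<-.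
have ext w : (2 * size w <= size (iter_word zeta K w))%N.
  elim: w => // a w IH; rewrite iter_word_cons size_cat /= mulnS.
  exact: leq_add.
have big q : (q < size (subst_iter zeta (K * q) ord0))%N.
  elim: q => [|q IH]; first by rewrite muln0.
  rewrite mulnS subst_iterD; apply: leq_trans (ext _).
  by move: IH; set s := size _; lia.
exists (take N (subst_iter zeta (K * N) ord0)); last first.
  by rewrite size_takel // ltnW.
apply: lang_infix (lang_subst_iter _ (K * N)%N ord0).
apply/infixP; exists [::], (drop N (subst_iter zeta (K * N) ord0)).
by rewrite cat_take_drop.
Qed.

(** Take a two-letter word of the language and iterate far enough: the block of its first letter
    contains [u], that of its second letter contains [v]. *)
Lemma lang_join u v : L u -> L v -> exists s, L (u ++ s ++ v).
Proof.
move=> /(lang_near zeta_prim)[k ku] /(lang_near zeta_prim)[l lv].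
have [[|a [|b []]] // /(lang_iter_word (k + l)) Lab _] := exists_lang_size 2.
move: Lab; rewrite !iter_word_cons iter_word_nil cats0.
have /infixP[s [s' ->]] := ku (k + l)%N (leq_addr _ _) a.
have /infixP[r [r' ->]] := lv (k + l)%N (leq_addl _ _) b.
move=> Lw; exists (s' ++ r); apply: lang_infix Lw.
by apply/infixP; exists s, r'; rewrite -!catA.
Qed.

Lemma lang_extend u : L u -> exists a, L (rcons u a).
Proof.
move=> Lu; have [w Lw w1] := exists_lang_size 1.
have [s Ls] := lang_join Lu Lw.
case e : (s ++ w) => [|a r]; first by case: s w {Lw Ls} w1 e => // -[].
exists a; apply: lang_infix Ls; apply/infixP; exists [::], r.
by rewrite e cat_rcons.
Qed.

(* Sliding a window of length n one letter to the right decreases its number of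
   zeros only when a leading 0 is dropped and a 1 enters. *)
Lemma sliding_window s v a : (0 < size v)%N ->
  (a <= zeros (take (size v) (s ++ v)))%N -> (zeros v < a)%N ->
  exists w, [/\ infix (ord0 :: rcons w ord_max) (s ++ v), (size w).+1 = size v &
    zeros (ord0 :: w) = a].
Proof.
move=> v0; elim: s => [|x s IH].
  rewrite take_size => h1 h2; lia.
move=> ha va; have [h|h] := leqP a (zeros (take (size v) (s ++ v))).
  have [w [h1 h2 h3]] := IH h va; exists w; split => //.
  exact: (infix_catl [:: x] h1).
set m := (size v).-1; have mE : size v = m.+1 by rewrite prednK.
have mv : (m < size (s ++ v))%N by rewrite size_cat mE addnS ltnS leq_addl.
move: ha h; rewrite cat_cons mE (take_nth ord0 mv) -cats1 count_cat.
rewrite [take _ (x :: _)]/= [zeros (x :: _)]/= [zeros [:: _]]/=.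
set y := nth _ _ _ => ha h.
have x0 : x = ord0.
  apply/eqP; apply: contraT => /negbTE xn; rewrite xn in ha.
  by case: (y == ord0) h => /= h; lia.
have y0 : y != ord0 by apply/negP => yn; move: ha h; rewrite x0 yn eqxx /=; lia.
have {}y0 : y = ord_max by case: (ord2P y) y0 => ->.
exists (take m (s ++ v)); split.
- apply/infixP; exists [::], (drop m.+1 (s ++ v)).
  by rewrite x0 -y0 -(take_nth ord0 mv) cat0s cat_cons cat_take_drop.
- by rewrite size_takel ?(ltnW mv).
by move: ha h; rewrite x0 y0 /=; lia.
Qed.

(** A discrete intermediate value argument along a word joining [u] to [v]. The initial 0 and the
    final 1 come from the step at which the count drops from [a] to [a - 1]. *)
Lemma lang_zeros_between u v n a : (0 < n)%N -> L u -> L v ->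
  size u = n -> size v = n -> (zeros v < a)%N -> (a <= zeros u)%N ->
  exists w, [/\ L (ord0 :: rcons w ord_max), (size w).+1 = n &
    zeros (ord0 :: w) = a].
Proof.
move=> n0 Lu Lv un vn va au; have [s Ls] := lang_join Lu Lv.
have [|||w [h1 h2 h3]] := @sliding_window (u ++ s) v a; rewrite ?vn //.
  by rewrite -catA take_size_cat.
exists w; split => //; last by rewrite h2.
by apply: lang_infix h1 _; rewrite -catA.
Qed.

(** * Spread of zero counts for an expanding second eigenvalue *)

Section Width.
Variables (R : realType) (d : 'I_2 -> R) (theta : R).
Hypothesis d_eigen : forall a, word_sum d (zeta a) = theta * d a.
Hypothesis theta_gt1 : 1 < `|theta|.

Lemma word_sum_windows (f : 'I_2 -> R) (c : R) n q w :
  (forall u, L u -> size u = n -> word_sum f u <= c) ->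
  L w -> size w = (q * n)%N -> word_sum f w <= c * q%:R.
Proof.
move=> fc; elim: q w => [|q IH] w Lw wq.
  by move: wq; rewrite mul0n => /size0nil ->; rewrite word_sum_nil mulr0.
rewrite -(cat_take_drop n w) word_sum_cat -natr1 mulrDr mulr1 addrC.
apply: lerD.
  apply: IH; last by rewrite size_drop wq mulSn addKn.
  apply: lang_infix Lw; apply/infixP; exists (take n w), [::].
  by rewrite cats0 cat_take_drop.
apply: fc; last by rewrite size_takel // wq mulSn leq_addr.
by apply: lang_infix Lw; apply/infixP; exists [::], (drop n w); rewrite cat_take_drop.
Qed.

(** The remainder is cut off on the left: for a supertile [w] it is then a prefix, to which
    [word_sum_prefix_expand] applies. *)
Lemma word_sum_windows_rem (f : 'I_2 -> R) (c : R) n w :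
  (forall u, L u -> size u = n -> word_sum f u <= c) -> L w ->
  word_sum f w <= word_sum f (take (size w %% n) w) + c * (size w %/ n)%:R.
Proof.
move=> fc Lw; set r := (size w %% n)%N.
rewrite -{1}(cat_take_drop r w) word_sum_cat lerD2l.
apply: word_sum_windows fc _ _.
  apply: lang_infix Lw; apply/infixP; exists (take r w), [::].
  by rewrite cats0 cat_take_drop.
by rewrite size_drop /r {1}(divn_eq (size w) n) addnK.
Qed.

(** If all words of length [n] had negative sum, cutting supertiles into such words would bound
    their sums above, although those of [i] are unbounded. Applied to [d] and to [- d], it yields
    sums of both signs. *)
Lemma exists_lang_sum_ge0 (f : 'I_2 -> R) n i :
  (forall a, word_sum f (zeta a) = theta * f a) -> 0 < f i ->
  exists u, [/\ L u, size u = n & 0 <= word_sum f u].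
Proof.
move=> f_eigen fi; apply: contrapT => no.
have neg u : L u -> size u = n -> word_sum f u <= 0.
  move=> Lu un; rewrite leNgt; apply/negP => u0.
  by apply: no; exists u; split => //; exact: ltW.
have [n0|n0] := posnP n.
  apply: no; exists [::]; rewrite n0 word_sum_nil; split => //.
  by exists 0%N, ord0; exact: infix0s.
have [M M0 fM] := word_sum_bound f.
(* The even exponent makes the power of [theta] positive whatever the sign of [theta]. *)
have [k /(_ k.*2)kP] := exists_expr_ge ((M * n%:R + 1) / f i) theta_gt1.
have Lw := lang_subst_iter zeta k.*2 i.
have := word_sum_windows_rem neg Lw; rewrite mul0r addr0 leNgt => /negP; apply.
apply: (@lt_le_trans _ _ (M * n%:R + 1)); last first.
  rewrite -iter_word1 (word_sum_iter_eigen f_eigen) word_sum_cons word_sum_nil.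
  rewrite addr0 -ler_pdivrMr //.
  have -> : theta ^+ k.*2 = `|theta| ^+ k.*2.
    by rewrite -muln2 mulnC !exprM real_normK ?num_real.
  by apply: kP; rewrite -addnn leq_addr.
apply: le_lt_trans (ler_norm _) _; apply: le_lt_trans (word_sum_norm_le _ fM) _.
apply: (@le_lt_trans _ _ (M * n%:R)); last by rewrite ltrDl.
apply: ler_wpM2l; first exact: ltW.
rewrite ler_nat size_take_min; apply: leq_trans (geq_minl _ _) _.
by rewrite ltnW // ltn_mod.
Qed.

Lemma word_sum2 (f : 'I_2 -> R) w :
  word_sum f w = (zeros w)%:R * (f ord0 - f ord_max) + (size w)%:R * f ord_max.
Proof.
elim: w => [|a w IH]; first by rewrite word_sum_nil !mul0r addr0.
rewrite word_sum_cons IH /= natrD -[(size w).+1]add1n natrD.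
by case: (ord2P a) => -> /=; lra.
Qed.

Hypotheses (d0_gt0 : 0 < d ord0) (d1_lt0 : d ord_max < 0).

Let d01 : 0 <= d ord0 - d ord_max.
Proof. by rewrite subr_ge0 ltW // (lt_trans d1_lt0). Qed.

(** For fixed length the sum is affine in the number of zeros, with slope [d ord0 - d ord_max].
    Since sums of both signs occur, the spread of the sums bounds each of them. *)
Lemma zeros_spread_bound B n :
  (forall u v, L u -> L v -> size u = n -> size v = n ->
    (zeros u <= zeros v + B)%N) ->
  forall u, L u -> size u = n -> `|word_sum d u| <= B%:R * (d ord0 - d ord_max).
Proof.
move=> hB u Lu un.
have opp_sum w : word_sum (fun a => - d a) w = - word_sum d w.
  by rewrite /word_sum sumrN.
have cmp v w : L v -> L w -> size v = n -> size w = n ->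
    word_sum d v <= word_sum d w + B%:R * (d ord0 - d ord_max).
  move=> Lv Lw vn wn; rewrite !word_sum2 vn wn.
  have h : (zeros v)%:R <= (zeros w)%:R + B%:R :> R by rewrite -natrD ler_nat hB.
  have := ler_wpM2r d01 h; rewrite [leRHS]mulrDl; lra.
have [v [Lv vn v0]] := exists_lang_sum_ge0 n d_eigen d0_gt0.
have [||w [Lw wn]] := @exists_lang_sum_ge0 (fun a => - d a) n ord_max.
- by move=> a; rewrite opp_sum d_eigen mulrN.
- by rewrite oppr_gt0.
rewrite opp_sum => w0.
rewrite ler_norml; have := cmp _ _ Lv Lu vn un; have := cmp _ _ Lu Lw un wn.
by move=> h1 h2; apply/andP; split; lra.
Qed.

Lemma size_subst_iter_unbounded N :
  exists k, forall j, (N < size (subst_iter zeta k j))%N.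
Proof.
have [w Lw wN] := exists_lang_size N.+1.
have [k /(_ k (leqnn k)) kP] := lang_near zeta_prim Lw.
by exists k => j; rewrite -wN; exact: size_infix.
Qed.

Lemma zeros_spread B : exists N, forall n, (N <= n)%N ->
  exists u v, [/\ L u, L v, size u = n, size v = n & (zeros v + B <= zeros u)%N].
Proof.
have th0 : 0 < `|theta| by apply: lt_trans theta_gt1.
have [E E0 EP] := word_sum_prefix_expand d_eigen theta_gt1.
have [m m0 zm] := size_bound zeta.
pose c0 := Num.min (d ord0) (- d ord_max).
have c00 : 0 < c0 by rewrite lt_min d0_gt0 oppr_gt0.
have c0P j : c0 <= `|d j|.
  rewrite /c0; case: (ord2P j) => ->; rewrite ge_min; apply/orP; [left|right].
    exact: ler_norm.
  by rewrite -normrN ler_norm.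
(* [K] does not depend on [n]: growth over [K.+1] levels must beat twice the bound for prefixes of
   level [k.+1]. *)
have [K /(_ K.+1 (leqnSn K)) KP] := exists_expr_ge (2 * E * `|theta| / c0) theta_gt1.
rewrite ler_pdivrMr // in KP.
pose B' := B%:R * (d ord0 - d ord_max).
have B'0 : 0 <= B' by apply: mulr_ge0.
(* Beyond level [k0] the prefix bound exceeds the contribution of the at most [m ^ K.+1] windows of
   length [n], so together they stay below twice the prefix bound. *)
have [k0 k0P] := exists_expr_ge (((m ^ K.+1)%:R * B' + 1) / (E * `|theta|)) theta_gt1.
exists (size (subst_iter zeta k0 ord0)) => n nN; apply: contrapT => no.
have n0 : (0 < n)%N by apply: leq_trans nN; exact: size_subst_iter_gt0.
have DB : forall u, L u -> size u = n -> `|word_sum d u| <= B'.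
  apply: zeros_spread_bound => u v Lu Lv un vn.
  rewrite leqNgt; apply/negP => h; apply: no; exists u, v; split => //.
  exact: ltnW.
have ex : exists k, [forall j, (n < size (subst_iter zeta k j))%N].
  by have [k kP] := size_subst_iter_unbounded n; exists k; apply/forallP.
(* The first level at which both supertiles are longer than [n]; one level below, some letter [j0]
   still has a supertile of length at most [n]. *)
case: (ex_minnP ex) => k' /forallP k'P k'min.
have kk' : (k0 < k')%N.
  rewrite ltnNge; apply/negP => h; have := leq_size_subst_iter zeta ord0 h.
  by have := k'P ord0; lia.
case: k' kk' k'P k'min => // k kk0 kP kmin.
have [j0 j0P] : exists j0, (size (subst_iter zeta k j0) <= n)%N.
  have : ~~ [forall j, (n < size (subst_iter zeta k j))%N].
    by apply/negP => /kmin; rewrite ltnn.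
  by rewrite negb_forall => /existsP[j]; rewrite -leqNgt; exists j.
pose W := subst_iter zeta (K.+1 + k) j0.
have LW : L W by exact: lang_subst_iter.
have qm : (size W %/ n <= m ^ K.+1)%N.
  rewrite -ltnS ltn_divLR // mulSn -[leqLHS]add1n; apply: leq_add => //.
  rewrite /W subst_iterD; apply: leq_trans (size_iter_word_le _ _ zm) _.
  exact: leq_mul.
(* The remainder is shorter than [n], hence lies inside the first supertile of level [k.+1] of
   [W]. *)
have remP : `|word_sum d (take (size W %% n) W)| <= E * `|theta| ^+ k.+1.
  have [b [w bw]] := subst_iter_cons zeta K j0.
  have -> : take (size W %% n) W = take (size W %% n) (subst_iter zeta k.+1 b).
    rewrite {2}/W (_ : K.+1 + k = k.+1 + K)%N; last by rewrite addSnnS addnC.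
    rewrite subst_iterD bw iter_word_cons takel_cat //.
    by apply: ltnW; apply: ltn_trans (kP b); rewrite ltn_mod.
  apply: (EP _ b _ (drop (size W %% n) (subst_iter zeta k.+1 b))).
  by rewrite cat_take_drop.
have qB : B' * (size W %/ n)%:R <= B' * (m ^ K.+1)%:R.
  by apply: ler_wpM2l => //; rewrite ler_nat.
have opp_sum w : word_sum (fun a => - d a) w = - word_sum d w.
  by rewrite /word_sum sumrN.
have DW : `|word_sum d W| <= E * `|theta| ^+ k.+1 + B' * (m ^ K.+1)%:R.
  have h1 := word_sum_windows_rem (fun u Lu un => le_trans (ler_norm _) (DB u Lu un)) LW.
  have h2 : word_sum (fun a => - d a) W <=
      word_sum (fun a => - d a) (take (size W %% n) W) + B' * (size W %/ n)%:R.
    apply: word_sum_windows_rem => // u Lu un; rewrite opp_sum.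
    apply: le_trans (ler_norm _) _; rewrite normrN; exact: DB.
  rewrite !opp_sum in h2; move: remP; rewrite ler_norml => /andP[h3 h4].
  by rewrite ler_norml; apply/andP; split; lra.
have WE : `|word_sum d W| = `|theta| ^+ K.+1 * `|theta| ^+ k * `|d j0|.
  rewrite /W -iter_word1 (word_sum_iter_eigen d_eigen).
  by rewrite word_sum_cons word_sum_nil addr0 normrM normrX exprD.
have X0 : 0 <= `|theta| ^+ k by exact: exprn_ge0.
have := k0P k kk0; rewrite ler_pdivrMr ?mulr_gt0 // => h0.
have h1 : `|theta| ^+ K.+1 * `|theta| ^+ k * c0 <= `|word_sum d W|.
  by rewrite WE; apply: ler_wpM2l (c0P j0); rewrite mulr_ge0 ?exprn_ge0.
have := ler_wpM2r X0 KP; rewrite exprS in DW.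
by lra.
Qed.

End Width.
End TwoLetters.

(** * Density of lengths *)

(** Division of the fixed [y] by the current combination [z] leaves [r]; the smaller of [r] and
    [z - r] is at most half of [z]. The coefficient [p] stays nonzero, so independence keeps [r]
    from vanishing. *)
Lemma small_integer_combination (R : realType) (x y eps : R) :
  0 < x -> 0 < y -> 0 < eps ->
  (forall p q : int, p%:~R * x + q%:~R * y = 0 -> p = 0) ->
  exists p q : int, 0 < p%:~R * x + q%:~R * y < eps.
Proof.
move=> x0 y0 e0 indep.
have halve k : exists p q : int, [/\ p != 0, 0 < p%:~R * x + q%:~R * y &
    (p%:~R * x + q%:~R * y) * 2 ^+ k <= y].
  elim: k => [|k [p [q [p0]]]].
    have /andP[h1 h2] := floor_itv (x / y).
    move: (Num.floor _) h1 h2 => f; rewrite ler_pdivlMr // ltr_pdivrMr //.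
    rewrite rmorphD rmorph1 mulrDl mul1r => h1 h2.
    have E : 1%:~R * x + (- f)%:~R * y = x - f%:~R * y by ring.
    have r0 : x - f%:~R * y != 0 by rewrite -E; apply/eqP => /indep/eqP; rewrite oner_eq0.
    exists 1, (- f); rewrite E; split => //; last by rewrite expr0 mulr1; lra.
    by rewrite lt0r r0 subr_ge0.
  set z := _ + _ => z0 zy.
  have pow0 : 1 <= 2 ^+ k :> R by apply: exprn_ege1; rewrite ler1n.
  have zy1 : z <= y by nra.
  have /andP[h1 h2] := floor_itv (y / z).
  move: (Num.floor _) h1 h2 => f; rewrite ler_pdivlMr // ltr_pdivrMr //.
  rewrite rmorphD rmorph1 mulrDl mul1r => h1 h2.
  have f0 : 0 < f.
    rewrite -(ltr_int R) ltNge; apply/negP => fle0.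
    by have := ler_wpM2r (ltW z0) fle0; rewrite mul0r; lra.
  have r0 : y - f%:~R * z != 0.
    apply/eqP => h; have := indep (- (f * p)) (1 - f * q).
    have -> : (- (f * p))%:~R * x + (1 - f * q)%:~R * y = y - f%:~R * z.
      by rewrite /z; ring.
    by move=> /(_ h)/eqP; rewrite oppr_eq0 mulf_eq0 (negbTE p0) gt_eqF.
  have [hr|hr] := leP ((y - f%:~R * z) * 2) z.
    exists (- (f * p)), (1 - f * q).
    have -> : (- (f * p))%:~R * x + (1 - f * q)%:~R * y = y - f%:~R * z.
      by rewrite /z; ring.
    split; [by rewrite oppr_eq0 mulf_neq0 // lt0r_neq0 | by rewrite lt0r r0; lra |].
    by rewrite exprS mulrA; nra.
  exists ((f + 1) * p), ((f + 1) * q - 1).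
  have -> : ((f + 1) * p)%:~R * x + ((f + 1) * q - 1)%:~R * y = (f%:~R * z + z) - y.
    by rewrite /z; ring.
  split; [by rewrite mulf_neq0 // lt0r_neq0 // addr_gt0 | lra |].
  by rewrite exprS mulrA; nra.
have [k /(_ k (leqnn k)) kP] := @exists_expr_ge R 2 (y / eps + 1) ltac:(by rewrite ltr1n).
have [p [q [_ z0 zy]]] := halve k; exists p, q; rewrite z0 /=.
rewrite -(ltr_pM2r (x := 2 ^+ k)) ?exprn_gt0 //.
apply: le_lt_trans zy _; apply: lt_le_trans (_ : eps * (y / eps + 1) <= _).
  by rewrite mulrDr mulrCA divff ?lt0r_neq0 // mulr1; lra.
by apply: ler_wpM2l => //; exact: ltW.
Qed.

Section Lengths.
Variable zeta : substitution 2.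
Hypothesis zeta_prim : primitive zeta.
Implicit Types (w u v : seq 'I_2).
Notation L := (lang zeta).
Notation zeros := (count_mem (ord0 : 'I_2)).

Definition is_max_zeros n A :=
  (exists u, [/\ L u, size u = n & zeros u = A]) /\
  forall v, L v -> size v = n -> (zeros v <= A)%N.

Lemma exists_max_zeros n : exists A, is_max_zeros n A.
Proof.
pose P A := `[< exists u, [/\ L u, size u = n & zeros u = A] >].
have exP : exists A, P A.
  have [w Lw wn] := exists_lang_size zeta_prim n.
  by exists (zeros w); apply/asboolP; exists w.
have ubP A : P A -> (A <= n)%N.
  by move=> /asboolP[u [_ <- <-]]; exact: count_size.
case: (ex_maxnP exP ubP) => A /asboolP PA Amax; exists A; split => // v Lv vn.
by apply: Amax; apply/asboolP; exists v.
Qed.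

(** Extend a maximal word of length [n] by a letter, and delete the first letter of a maximal word
    of length [n.+1]. *)
Lemma max_zerosS n A A' : is_max_zeros n A -> is_max_zeros n.+1 A' ->
  (A <= A' <= A.+1)%N.
Proof.
move=> [[u [Lu un <-]] uP] [[v [Lv vn <-]] vP]; apply/andP; split.
  have [a La] := lang_extend zeta_prim Lu.
  apply: leq_trans (vP _ La _); last by rewrite size_rcons un.
  by rewrite -cats1 count_cat leq_addr.
case: v Lv vn {vP} => // a v Lv [vn].
have /uP/(_ vn) : L v by apply: lang_infix Lv; exact: (suffix_infix [:: a] v).
by rewrite /=; case: (a == ord0) => /=; lia.
Qed.

Variables (R : realType) (T : 'I_2 -> R).
Hypothesis T_gt0 : forall a, 0 < T a.
Hypothesis T_indep : forall p q : int,
  p%:~R * T ord0 + q%:~R * T ord_max = 0 -> p = 0.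
Hypothesis spread : forall B, exists N, forall n, (N <= n)%N ->
  exists u v, [/\ L u, L v, size u = n, size v = n & (zeros v + B <= zeros u)%N].

(** First [g] is approximated from below, with bounded error, by the length belonging to a zero
    count well inside the admissible range. Adding a multiple of the small combination [del] then
    removes the error up to [eps] without leaving that range. *)
Lemma length_dense (eps : R) : 0 < eps -> exists r : R, forall g, r <= g ->
  exists w, L (ord0 :: rcons w ord_max) /\ `|word_sum T (ord0 :: w) - g| < eps.
Proof.
move=> e0; have [A AP] := choice exists_max_zeros.
have T0 := T_gt0 ord0; have T1 := T_gt0 ord_max.
have [p [q /andP[del0 dele]]] := small_integer_combination T0 T1 e0 T_indep.
set del := _ + _ in del0 dele.
pose Tm := T ord0 + T ord_max.
pose smax := Num.bound (Tm / del).
have smaxP : Tm < smax%:R * del.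
  by rewrite -ltr_pdivrMr // archi_boundP // divr_ge0 // ltW // addr_gt0.
(* Room for a correction by [s * p] zeros and [s * q] ones with [s <= smax]: the zero count moves by
   at most [s * |p|], the maximum [A] by at most [s * (|p| + |q|)]. *)
have [B BE] : exists B, B = (smax * (2 * `|p| + `|q|))%N by eexists.
(* The corrected count lies at most [2 * B] below the maximum, hence above the zero count of the
   poorer word. The same bound keeps [A n0 - B + X] nonnegative. *)
have [N NP] := spread (4 * B + 2)%N.
have AS n : (A n <= A n.+1 <= (A n).+1)%N by apply: max_zerosS.
have Alip n k : (A n <= A (n + k) <= A n + k)%N.
  elim: k => [|k IH]; first by rewrite !addn0 leqnn.
  by rewrite addnS; have := AS (n + k)%N; lia.
(* The length that a word of [n] letters with [A n - B] zeros would have; it increases by less than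
   [Tm] per letter. *)
pose phi n : R := n%:R * T ord_max + ((A n)%:R - B%:R) * (T ord0 - T ord_max).
have phiS n : phi n + Num.min (T ord0) (T ord_max) <= phi n.+1 < phi n + Tm.
  have : A n.+1 = A n \/ A n.+1 = (A n).+1 by have := AS n; lia.
  rewrite /phi /Tm => -[] ->; rewrite -!natr1;
    case: (leP (T ord0) (T ord_max)) => h; apply/andP; split; lra.
(* The summand [B + 1] keeps the corrected number of letters [ns] above [N]. *)
pose n1 := (N + B + 1)%N.
have phi_ge k : phi n1 + k%:R * Num.min (T ord0) (T ord_max) <= phi (n1 + k)%N.
  elim: k => [|k IH]; first by rewrite mul0r addr0 addn0.
  by rewrite addnS -natr1; have /andP[+ _] := phiS (n1 + k)%N; lra.
exists (phi n1) => g hg.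
have exk : exists k, g < phi (n1 + k)%N.
  exists (Num.bound (`|g - phi n1| / Num.min (T ord0) (T ord_max))).
  apply: lt_le_trans (phi_ge _); rewrite -ltrBlDl.
  apply: le_lt_trans (ler_norm _) _.
  have mT : 0 < Num.min (T ord0) (T ord_max) by rewrite lt_min T0.
  by rewrite -ltr_pdivrMr // archi_boundP // divr_ge0 // ltW.
case: (ex_minnP exk) => -[|k] kP kmin.
  by rewrite addn0 in kP; have := lt_le_trans kP hg; rewrite ltxx.
have {kmin} gk : phi (n1 + k)%N <= g.
  by rewrite leNgt; apply/negP => /kmin; rewrite ltnn.
have [n0 n0E] : exists n0, n0 = (n1 + k)%N by eexists.
rewrite -n0E in gk; rewrite addnS -n0E in kP.
have gn0 : g - phi n0 < Tm by have /andP[_ +] := phiS n0; lra.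
have /andP[s1 s2] : (Num.truncn ((g - phi n0) / del))%:R <= (g - phi n0) / del
    < (Num.truncn ((g - phi n0) / del)).+1%:R.
  by apply: truncn_itv; apply: divr_ge0; [rewrite subr_ge0 | exact: ltW].
move: s1 s2; set s := Num.truncn _; rewrite ler_pdivlMr // ltr_pdivrMr // => s1 s2.
have sm : (s <= smax)%N.
  by rewrite -(ler_nat R) -(ler_pM2r del0); lra.
have sB : (s * (2 * `|p| + `|q|) <= B)%N by rewrite BE leq_mul.
have n0B : (N + B + 1 <= n0)%N by rewrite n0E /n1 leq_addr.
have {sB} : (2 * `|(s%:Z * p)%R| + `|(s%:Z * q)%R| <= B)%N.
  by rewrite !abszM !absz_nat mulnCA -mulnDr.
have [X XE] : exists X : int, X = s%:Z * p by exists (s%:Z * p).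
have [Y YE] : exists Y : int, Y = s%:Z * q by exists (s%:Z * q).
rewrite -XE -YE => XY.
have [ns nsE] : exists ns : nat, ns%:Z = n0%:Z + X + Y.
  by exists (absz (n0%:Z + X + Y)); clear -XY n0B; lia.
have Nns : (N < ns)%N by clear -XY n0B nsE; lia.
have [An0 Ans] : (A n0 <= A ns + absz (X + Y)%R /\ A ns <= A n0 + absz (X + Y)%R)%N.
  have [h|/ltnW h] := leqP n0 ns.
    have E : absz (X + Y) = (ns - n0)%N by clear -h nsE; lia.
    have := Alip n0 (ns - n0)%N; rewrite E (subnKC h).
    by move: (A n0) (A ns) => a b; clear; lia.
  have E : absz (X + Y) = (n0 - ns)%N by clear -h nsE; lia.
  have := Alip ns (n0 - ns)%N; rewrite E (subnKC h).
  by move: (A n0) (A ns) => a b; clear; lia.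
have A4B : (4 * B + 2 <= A n0)%N.
  have [|u [v [Lu _ un _ uv]]] := NP n0; first by clear -n0B; lia.
  by have [_ /(_ u Lu un)] := AP n0; clear -uv; lia.
have [a aE] : exists a : nat, a%:Z = (A n0)%:Z - B%:Z + X.
  by exists (absz ((A n0)%:Z - B%:Z + X)); clear -A4B XY; lia.
have [|u' [v [Lu' Lv u'n vn u'v]]] := NP ns; first exact: ltnW.
have [[u [Lu un uA]] /(_ u' Lu' u'n) u'A] := AP ns.
have [|||w [Lw wn wa]] := @lang_zeros_between _ zeta_prim u v ns a _ Lu Lv un vn.
- by clear -Nns; lia.
- by clear -aE XY u'v u'A An0 Ans; lia.
- by clear -aE XY uA An0 Ans; lia.
exists w; split => //.
have -> : word_sum T (ord0 :: w) = phi n0 + s%:R * del.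
  rewrite word_sum2 wa [size _]/= wn /phi /del.
  have -> : a%:R = (A n0)%:R - B%:R + s%:R * p%:~R :> R.
    by rewrite -[LHS]/(a%:Z%:~R) aE XE; ring.
  have -> : ns%:R = n0%:R + s%:R * (p%:~R + q%:~R) :> R.
    by rewrite -[LHS]/(ns%:Z%:~R) nsE XE YE; ring.
  ring.
rewrite -natr1 in s2; rewrite ltr_norml; apply/andP; split; lra.
Qed.

End Lengths.

(** * Tilings as sequences of tiles *)

Section TilingSequence.
Variables (R : realType) (n : nat) (zeta : substitution n).
Variable t : 'I_n -> {posnum R}.
Implicit Types (S : tiling_space zeta t) (u v : tile R n) (k : nat).

Local Open Scope classical_set_scope.

Definition tlen (w : seq 'I_n) : R := word_sum (fun a => (t a)%:num) w.

(** The default [u] is returned if no tile starts there; [nextP] rules this out for tiles of [S]. *)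
Definition next_tile S u : tile R n :=
  xget u [set v | tiles S v /\ v.2 = u.2 + (t u.1)%:num].

Definition labels S u k : seq 'I_n := map fst (traject (next_tile S) u k).

Lemma tile_length_bound :
  exists2 tmin : R, 0 < tmin & forall a, tmin <= (t a)%:num.
Proof.
exists (\big[Num.min/1]_a (t a)%:num).
  by elim/big_ind: _ => // x y x0 y0; rewrite lt_min x0.
move=> a; rewrite (bigD1 a) //= ge_min lexx //.
Qed.

Lemma same_position S u v : tiles S u -> tiles S v -> u.2 = v.2 -> u = v.
Proof.
move=> Su Sv uv; apply: (is_tiling_overlap (tiles_tiling S) Su Sv).
  by rewrite uv ltrDl.
by rewrite uv ltrDl.
Qed.

Lemma nextP S u : tiles S u ->
  tiles S (next_tile S u) /\ (next_tile S u).2 = u.2 + (t u.1)%:num.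
Proof.
move=> Su; suff [v Pv] : exists v, tiles S v /\ v.2 = u.2 + (t u.1)%:num.
  exact: (xgetPex u (ex_intro [set v | tiles S v /\ v.2 = u.2 + (t u.1)%:num] v Pv)).
have tS := tiles_tiling S; have [cS _] := tS.
have [tmin tmin0 tminP] := tile_length_bound.
set b := u.2 + _; have hu : 0 < (t u.1)%:num by [].
have right x : b < x -> exists v, [/\ tiles S v, b <= v.2, v.2 <= x &
    x <= v.2 + (t v.1)%:num].
  move=> bx; have : [set: R] x by []; rewrite -cS {cS} => -[v Sv /tile_suppE[h1 h2]].
  exists v; split => //; rewrite leNgt; apply/negP => vb.
  have uv : u = v.
    by apply: (is_tiling_overlap tS Su Sv) => //; rewrite /b in bx vb *; lra.
  by rewrite -uv -/b in h2; lra.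
(* If the tile [v] covering [b + tmin / 2] started after [b], a tile covering the midpoint of [b]
   and [v.2] would start at or after [b], have length at least [tmin], and so overlap [v]. *)
clear cS; have [|v [Sv bv vx xv]] := right (b + tmin / 2); first lra.
move: bv; rewrite le_eqVlt => /predU1P[bv|bv]; first by exists v.
have [|w [Sw bw wx xw]] := right ((b + v.2) / 2); first lra.
have hv := tminP v.1; have hw := tminP w.1.
have wv : w = v by apply: (is_tiling_overlap tS Sw Sv); lra.
by rewrite wv in wx; lra.
Qed.

Lemma next_unique S u v :
  tiles S u -> tiles S v -> v.2 = u.2 + (t u.1)%:num -> v = next_tile S u.
Proof.
move=> Su Sv vu; have [Sn nu] := nextP Su.
by apply: same_position Sv Sn _; rewrite vu nu.
Qed.

Lemma iter_nextP S u k : tiles S u -> tiles S (iter k (next_tile S) u).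
Proof. by move=> Su; elim: k => //= k /nextP[]. Qed.

Lemma labelsS S u k : labels S u k.+1 = u.1 :: labels S (next_tile S u) k.
Proof. by []. Qed.

Lemma labelsD S u k l :
  labels S u (k + l) = labels S u k ++ labels S (iter k (next_tile S) u) l.
Proof. by rewrite /labels trajectD map_cat. Qed.

Lemma size_labels S u k : size (labels S u k) = k.
Proof. by rewrite size_map size_traject. Qed.

Lemma iter_next_pos S u k : tiles S u ->
  (iter k (next_tile S) u).2 = u.2 + tlen (labels S u k).
Proof.
elim: k u => [|k IH] u Su; first by rewrite /tlen word_sum_nil addr0.
have [Sn nu] := nextP Su.
by rewrite iterSr IH // labelsS /tlen word_sum_cons nu addrA.
Qed.

Lemma tlen_ge (tmin : R) w : (forall a, tmin <= (t a)%:num) ->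
  tmin * (size w)%:R <= tlen w.
Proof.
move=> h; elim: w => [|a w IH]; first by rewrite mulr0 /tlen word_sum_nil.
by rewrite /tlen word_sum_cons /= -add1n natrD mulrDr mulr1; apply: lerD.
Qed.

Lemma tlen_ge0 w : 0 <= tlen w.
Proof.
rewrite -[leLHS](mul0r (size w)%:R); apply: tlen_ge => a; exact: ltW.
Qed.

Lemma reach_next S u v : tiles S u -> tiles S v -> u.2 <= v.2 ->
  exists k, v = iter k (next_tile S) u.
Proof.
move=> Su Sv uv; have [tmin tmin0 tminP] := tile_length_bound.
have exk : exists k, v.2 < (iter k (next_tile S) u).2.
  exists (Num.bound ((v.2 - u.2) / tmin)); rewrite iter_next_pos //.
  rewrite -ltrBlDl; apply: lt_le_trans (tlen_ge _ tminP).
  rewrite size_labels mulrC -ltr_pdivrMr // archi_boundP //.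
  by apply: divr_ge0; [rewrite subr_ge0 | exact: ltW].
case: (ex_minnP exk) => -[|k] /= kP kmin.
  by have := le_lt_trans uv kP; rewrite ltxx.
exists k; have Sk := iter_nextP k Su; have [_ nk] := nextP Sk.
apply: (is_tiling_overlap (tiles_tiling S) Sv Sk); first by rewrite -nk.
suff : (iter k (next_tile S) u).2 <= v.2 by have : 0 < (t v.1)%:num by []; lra.
by rewrite leNgt; apply/negP => /kmin; rewrite ltnn.
Qed.


Lemma iter_next_le_end S u v k : tiles S u -> tiles S v -> u.2 <= v.2 ->
  v.2 + (t v.1)%:num <=
    (iter k (next_tile S) u).2 + (t (iter k (next_tile S) u).1)%:num ->
  exists2 j, (j <= k)%N & v = iter j (next_tile S) u.
Proof.
move=> Su Sv uv; have [j ->] := reach_next Su Sv uv => h.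
exists j => //; rewrite leqNgt; apply/negP => kj.
move: h; rewrite -(subnK kj) iterD iterS.
have Sk := iter_nextP k Su.
set w := iter k _ _ in Sk *.
have [Sn nw] := nextP Sk; have Sj := iter_nextP (j - k.+1) Sn.
rewrite iter_next_pos // nw.
have := tlen_ge0 (labels S (next_tile S w) (j - k.+1)).
set z := iter _ _ _; have : 0 < (t z.1)%:num by [].
lra.
Qed.

Lemma patch_tile_seq S u k : tiles S u ->
  let P := [set` traject (next_tile S) u k.+1] in
  [/\ P `<=` S, is_patch t P & patch_labels P (labels S u k.+1)].
Proof.
move=> Su P.
have PE v : P v <-> exists2 j, (j <= k)%N & v = iter j (next_tile S) u.
  split => [/trajectP[j jk ->]|[j jk ->]]; first by exists j.
  by apply/trajectP; exists j.
have PS : P `<=` S by move=> v /PE[j _ ->]; exact: iter_nextP.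
have Sk := iter_nextP k Su.
have uk : u.2 < (iter k (next_tile S) u).2 + (t (iter k (next_tile S) u).1)%:num.
  rewrite iter_next_pos // -addrA ltrDl; apply: ltr_wpDl => //; exact: tlen_ge0.
split => //.
  exists u.2, ((iter k (next_tile S) u).2 + (t (iter k (next_tile S) u).1)%:num).
  split => //; suff -> : P = [set w | [/\ tiles S w, u.2 <= w.2 &
      w.2 + (t w.1)%:num <=
        (iter k (next_tile S) u).2 + (t (iter k (next_tile S) u).1)%:num]].
    exact: is_tiling_restrict (tiles_tiling S) Su Sk uk.
  apply/seteqP; split => [v /PE[j jk ->]|v [Sv uv vk]]; last first.
    by apply/PE; exact: iter_next_le_end vk.
  have Sj := iter_nextP j Su; split => //.
    by rewrite iter_next_pos // lerDl tlen_ge0.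
  move: jk; rewrite leq_eqVlt => /predU1P[-> //|jk].
  have [Sn nj] := nextP Sj; rewrite -nj.
  rewrite -(subnK jk) iterD iterS.
  rewrite [(iter (k - j.+1) _ _).2]iter_next_pos //.
  by rewrite -addrA lerDl; apply: addr_ge0 => //; exact: tlen_ge0.
exists (traject (next_tile S) u k.+1); split => //.
rewrite /=; elim: k u Su {P PE PS Sk uk} => //= k IH u Su.
have [Sn nu] := nextP Su; rewrite IH // andbT nu ltrDl.
by [].
Qed.

Lemma labels_allowed S u k : tiles S u -> allowed zeta (labels S u k.+1).
Proof. by move=> /(patch_tile_seq k)[]; exact: tiles_allowed. Qed.

Lemma allowed_lang w : (0 < n)%N -> allowed zeta w -> lang zeta w.
Proof.
move=> n0 [x Xx [a ->]]; have := Xx a (size w) (Ordinal n0).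
by move=> [k _ /(_ k (leqnn k))]; exists k, (Ordinal n0).
Qed.

Lemma labels_lang S u k : tiles S u -> lang zeta (labels S u k).
Proof.
move=> Su; case: k => [|k]; last first.
  by apply: allowed_lang (labels_allowed k Su); case: (u.1) => i; exact: leq_ltn_trans.
by exists 0%N, u.1; exact: infix0s.
Qed.

Lemma lang_occurs S u w : primitive zeta -> tiles S u -> lang zeta w ->
  exists m, labels S (iter m (next_tile S) u) (size w) = w.
Proof.
move=> zeta_prim Su /(lang_in_long zeta_prim)[M MP].
have := MP _ (labels_lang M Su); rewrite size_labels leqnn => /(_ isT).
move=> /infixP[s [s' e]]; exists (size s).
have Me : M = (size s + (size w + size s'))%N.
  by rewrite -(size_labels S u M) e !size_cat.
move: e; rewrite Me !labelsD => /eqP; rewrite eqseq_cat ?size_labels //.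
move=> /andP[_]; rewrite eqseq_cat ?size_labels // => /andP[/eqP -> _].
by [].
Qed.

Lemma same_labels S S' u u' k j : tiles S u -> tiles S' u' ->
  labels S' u' k = labels S u k -> (j < k)%N ->
  iter j (next_tile S') u' =
  ((iter j (next_tile S) u).1, (iter j (next_tile S) u).2 + (u'.2 - u.2)).
Proof.
move=> Su Su' e jk; apply/eqP; rewrite -pair_eqE /pair_eq /=.
move: e; rewrite -(subnKC jk) addSnnS !labelsD => /eqP.
rewrite eqseq_cat ?size_labels // => /andP[/eqP e].
rewrite !labelsS => /eqP[-> _]; rewrite eqxx /=.
rewrite !iter_next_pos // e; apply/eqP; ring.
Qed.

(** With [labels_nbhs] this describes the topology: nearness means having a tile at nearly the same
    position, followed by the same finite sequence of labels. *)
Lemma open_labels (U : set (tiling_space zeta t)) S : open U -> U S ->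
  exists u k eps, [/\ tiles S u, 0 < eps & forall S' u', tiles S' u' ->
    `|u'.2 - u.2| < eps -> labels S' u' k = labels S u k -> U S'].
Proof.
move=> -[D sD <-] [[P e] DPe /= [y ye PS]].
have [/= pP e0] := sD _ DPe.
have [a [b [ab tP]]] := is_patch_shift y pP.
have [[u Pu ua] [v Pv vb]] := is_tiling_itv_ends ab tP.
have Su := PS _ Pu; have Sv := PS _ Pv.
have [k vk] : exists k, v = iter k (next_tile S) u.
  by apply: reach_next => //; have [] := is_tiling_itv_bounds tP Pv; rewrite ua.
move: ye; rewrite in_itv /= => /andP[y1 y2].
exists u, k.+1, (Num.min (e - y) (e + y)); split => //.
  by rewrite lt_min; apply/andP; split; lra.
move=> S' u' Su' u'u lab; exists (P, e) => //=.
exists (y - (u'.2 - u.2)).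
  move: u'u; rewrite lt_min !ltr_norml in_itv /= => /andP[/andP[h1 h2] /andP[h3 h4]].
  by apply/andP; split; lra.
rewrite -shiftD => _ [w Pw <-].
have Sw := PS _ Pw; have [h1 h2] := is_tiling_itv_bounds tP Pw.
have [||j jk wj] := @iter_next_le_end S u w k Su Sw; rewrite ?ua -?vk ?vb //.
have := iter_nextP j Su'.
rewrite (same_labels Su Su' lab) // -wj; congr (tiles S' (_, _)).
by rewrite /=; lra.
Qed.

Lemma labels_nbhs S u k (eps : R) : tiles S u -> 0 < eps ->
  nbhs S [set S' | exists u', [/\ tiles S' u', `|u'.2 - u.2| < eps &
    labels S' u' k.+1 = labels S u k.+1]].
Proof.
move=> Su e0; have [PS pP _] := patch_tile_seq k Su.
set P := [set` _] in PS pP.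
have oP : open (basic_open P eps : set (tiling_space zeta t)).
  exists [set (P, eps)]; first by move=> _ ->; exact: (conj pP e0).
  exact: (bigcup_set1 (fun i => basic_open i.1 i.2) (P, eps)).
have SP : basic_open P eps S.
  by exists 0; [rewrite in_itv /=; lra | rewrite Defs.shift0].
apply: filterS (open_nbhs_nbhs (conj oP SP)) => S' [y].
rewrite in_itv /= => /andP[y1 y2] PS'.
have S'j j : (j <= k)%N ->
    tiles S' ((iter j (next_tile S) u).1, (iter j (next_tile S) u).2 - y).
  move=> jk; apply: PS'; exists (iter j (next_tile S) u) => //.
  by apply/trajectP; exists j.
exists (u.1, u.2 - y); split; first exact: (S'j 0%N).
  by rewrite /= ltr_norml; apply/andP; split; lra.
have step j : (j <= k)%N -> iter j (next_tile S') (u.1, u.2 - y) =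
    ((iter j (next_tile S) u).1, (iter j (next_tile S) u).2 - y).
  elim: j => // j IH jk; rewrite /= IH ?(ltnW jk) //; symmetry.
  have [_ nj] := nextP (iter_nextP j Su).
  apply: next_unique; [exact: S'j (ltnW jk) | exact: S'j jk |].
  by rewrite /= nj; lra.
apply: (@eq_from_nth _ u.1); rewrite !size_labels // => j jk.
rewrite /labels (nth_map (u.1, u.2 - y)) ?size_traject //.
by rewrite (nth_map u) ?size_traject // !nth_traject // step.
Qed.

Lemma labels_action g S u k : tiles S u ->
  tiles (tiling_action zeta t g S) (u.1, u.2 - g) /\
  labels (tiling_action zeta t g S) (u.1, u.2 - g) k = labels S u k.
Proof.
move=> Su; split; first by exists u.
elim: k u Su => // k IH u Su; rewrite !labelsS /=; congr (_ :: _).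
have [Sn nu] := nextP Su; rewrite -(IH _ Sn); congr (labels _ _ _).
symmetry; apply: next_unique; [by exists u | by exists (next_tile S u) |].
by rewrite /= nu; lra.
Qed.

End TilingSequence.

(** * Eigenfunctions and mixing *)

Section Expi.
Variable R : realType.
Implicit Types x y : R.

Lemma expiD x y : expi (x + y) = expi x * expi y.
Proof.
rewrite /expi mulrDr cosD sinD; apply/eqP; rewrite eq_complex /=.
by apply/andP; split; apply/eqP; ring.
Qed.

Lemma expi0 : expi (0 : R) = 1.
Proof. by rewrite /expi mulr0 cos0 sin0. Qed.

Lemma expi_neq0 x : expi x != 0.
Proof.
apply/eqP => h; have := expiD x (- x).
by rewrite subrr expi0 h mul0r => /eqP; rewrite oner_eq0.
Qed.

Lemma norm_expi x : `|expi x| = 1.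
Proof. by rewrite normc_def /= cos2Dsin2 sqrtr1. Qed.

Lemma expi1 : expi (1 : R) = 1.
Proof. by rewrite /expi mulr1 mulr_natl cos2pi sin2pi. Qed.

Lemma expi_half : expi (2^-1 : R) = -1.
Proof.
rewrite /expi mulrAC divff ?mul1r // cospi sinpi.
by apply/eqP; rewrite eq_complex /= oppr0 !eqxx.
Qed.

Lemma expi_nat (k : nat) : expi (k%:R : R) = 1.
Proof.
by elim: k => [|k IH]; [exact: expi0 | rewrite -natr1 expiD IH expi1 mulr1].
Qed.

Lemma expi_int (m : int) : expi (m%:~R : R) = 1.
Proof.
case: m => k; first exact: expi_nat.
have := expiD (- k.+1%:R) k.+1%:R.
by rewrite addNr expi0 expi_nat mulr1 NegzE rmorphN.
Qed.

Lemma normc_real x : `|x%:C| = `|x|%:C.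
Proof. by rewrite normc_def /= expr0n addr0 sqrtr_sqr. Qed.

Lemma normc_imag x : `|0 +i* x| = `|x|%:C.
Proof. by rewrite normc_def /= expr0n add0r sqrtr_sqr. Qed.

Lemma expi_near1 (eps : R[i]) : 0 < eps ->
  exists2 eta : R, 0 < eta & forall x, `|x| < eta -> `|expi x - 1| < eps.
Proof.
(* Positivity in the order of [R[i]] forces [eps] to be real. *)
rewrite ltcE /= => /andP[/eqP im0 re0].
have e20 : 0 < complex.Re eps / 2 by rewrite divr_gt0.
have c0 : ((fun x : R => cos (2 * pi * x)) x @[x --> 0] -->
    cos (2 * pi * (0 : R)))%classic.
  apply: (continuous_comp (f := fun x : R => 2 * pi * x)); last exact: continuous_cos.
  exact: mulrl_continuous.
have s0 : ((fun x : R => sin (2 * pi * x)) x @[x --> 0] -->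
    sin (2 * pi * (0 : R)))%classic.
  apply: (continuous_comp (f := fun x : R => 2 * pi * x)); last exact: continuous_sin.
  exact: mulrl_continuous.
rewrite mulr0 cos0 in c0; rewrite mulr0 sin0 in s0.
move/cvgrPdist_lt/(_ _ e20): c0 => /nbhs_ballP[e1 e10 h1].
move/cvgrPdist_lt/(_ _ e20): s0 => /nbhs_ballP[e2 e20' h2].
exists (Num.min e1 e2); first by rewrite lt_min e10 e20'.
move=> x; rewrite lt_min => /andP[xe1 xe2].
have {}h1 : `|1 - cos (2 * pi * x)| < complex.Re eps / 2.
  by apply: h1; rewrite /ball /= sub0r normrN.
have {}h2 : `|0 - sin (2 * pi * x)| < complex.Re eps / 2.
  by apply: h2; rewrite /ball /= sub0r normrN.
rewrite sub0r normrN in h2; rewrite distrC in h1.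
have -> : expi x - 1 = (cos (2 * pi * x) - 1)%:C + (0 +i* sin (2 * pi * x)).
  by apply/eqP; rewrite eq_complex /= addr0 subr0 add0r !eqxx.
apply: le_lt_trans (ler_normD _ _) _; rewrite normc_real normc_imag.
by rewrite ltcE /= im0 addr0 eqxx /=; lra.
Qed.

End Expi.

Lemma mixing_weakly_mixing (R : realType) (X : topologicalType)
    (T : R -> X -> X) : topologically_mixing T -> weakly_mixing T.
Proof.
move=> mixT f fcont [[x0 fx0] [lam fT]]; exists (f x0) => y0.
apply/eqP; apply: contrapT => /negP; rewrite -subr_eq0 -normr_gt0 => ne.
set e := `|f y0 - f x0| / 2.
have e0 : 0 < e by rewrite divr_gt0.
have nb x : exists2 U : set X, open U /\ U x & forall z, U z -> `|f x - f z| < e.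
  have /cvgrPdist_lt/(_ _ e0) := fcont x.
  rewrite /prop_near1 nbhsE => -[B [oB Bx] BP]; exists B => //.
have [U [oU Ux] UP] := nb x0; have [V [oV Vy] VP] := nb y0.
have [r r0 rP] := mixT U V oU oV (ex_intro _ _ Ux) (ex_intro _ _ Vy).
have [g rg eg] : exists2 g : R, r <= `|g| & expi (lam * g) = 1.
  have [->|l0] := eqVneq lam 0; first by exists r; rewrite ?ler_norm // mul0r expi0.
  exists ((Num.bound (r * `|lam|))%:R / lam).
    rewrite normrM normfV normr_nat ler_pdivlMr ?normr_gt0 // ltW // archi_boundP //.
    by rewrite mulr_ge0 // ltW.
  by rewrite mulrC divfK // expi_nat.
have [z [Uz [v Vv zE]]] := rP g rg; have := UP _ Uz; have := VP _ Vv.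
rewrite -zE fT eg mul1r => h1 h2.
have : `|f y0 - f x0| < `|f y0 - f x0|.
  apply: le_lt_trans (ler_distD (f v) (f y0) (f x0)) _; rewrite (distrC (f v)).
  by rewrite [ltRHS](splitr `|_|) ltrD.
by rewrite ltxx.
Qed.

(** * A continuous eigenfunction from bounded sums *)

Section Eigenfunction.
Variables (R : realType) (n : nat) (zeta : substitution n).
Variable t : 'I_n -> {posnum R}.
Hypothesis zeta_prim : primitive zeta.
Variable d : 'I_n -> R.
Hypothesis d_bounded : exists C : R, forall w, lang zeta w -> `|word_sum d w| <= C.
Implicit Types (S : tiling_space zeta t) (u : tile R n).

Local Open Scope classical_set_scope.

Definition partial_sum S u k : R := word_sum d (labels S u k).

Definition max_partial_sum S u : R := sup (range (partial_sum S u)).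

Lemma partial_sumS S u k :
  partial_sum S u k.+1 = d u.1 + partial_sum S (next_tile S u) k.
Proof. by rewrite /partial_sum labelsS word_sum_cons. Qed.

Definition discrepancy : R := sup [set `|word_sum d w| | w in lang zeta].

Lemma le_discrepancy w : lang zeta w -> `|word_sum d w| <= discrepancy.
Proof.
move=> Lw; apply: ub_le_sup; last by exists w.
by have [C CP] := d_bounded; exists C => _ [v Lv <-]; exact: CP.
Qed.

Lemma partial_sumB_le S u j k : tiles S u ->
  partial_sum S u j - partial_sum S u k <= discrepancy.
Proof.
move=> Su; wlog jk : / (j <= k)%N \/ (k <= j)%N.
  by apply; apply/orP; exact: leq_total.
have split_ l m : (l <= m)%N -> `|partial_sum S u m - partial_sum S u l| <= discrepancy.
  move=> lm; rewrite /partial_sum -(subnKC lm) labelsD word_sum_cat addrC addKr.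
  by apply: le_discrepancy; apply: labels_lang; exact: iter_nextP.
apply: le_trans (ler_norm _) _.
by case: jk => /split_ //; rewrite distrC.
Qed.

Lemma le_max_partial_sum S u k : tiles S u ->
  partial_sum S u k <= max_partial_sum S u.
Proof.
move=> Su; apply: ub_le_sup; last by exists k.
exists (partial_sum S u 0 + discrepancy) => _ [j _ <-].
by rewrite -lerBlDl; exact: partial_sumB_le.
Qed.

(** No partial sum exceeds the one at [j] by more than the discrepancy, so the one at [i] is maximal
    up to [eta]. Finitely many labels thus determine the maximum up to [eta]. *)
Lemma max_partial_sum_le S u i j eta : tiles S u ->
  discrepancy - eta < partial_sum S u i - partial_sum S u j ->
  max_partial_sum S u <= partial_sum S u i + eta.
Proof.
move=> Su h; apply: ge_sup; first by exists (partial_sum S u 0); exists 0%N.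
by move=> _ [k _ <-]; have := partial_sumB_le k j Su; lra.
Qed.

(** A nearly extremal word occurs to the right of [u]; the sign of its sum decides which of its ends
    is [i]. *)
Lemma exists_discrepancy S u eta : tiles S u -> 0 < eta ->
  exists i j, discrepancy - eta < partial_sum S u i - partial_sum S u j.
Proof.
move=> Su eta0.
have [|_ [w Lw <-] hw] := @sup_adherent R
    [set `|word_sum d w| | w in lang zeta] eta eta0.
  split; first by exists `|word_sum d [::]|, [::] => //; exact: (labels_lang 0 Su).
  by exists discrepancy => _ [w Lw <-]; exact: le_discrepancy.
have [m mw] := lang_occurs zeta_prim Su Lw.
have wE : word_sum d w = partial_sum S u (m + size w) - partial_sum S u m.
  by rewrite /partial_sum labelsD word_sum_cat mw addrC addKr.
move: hw; rewrite wE.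
case: (leP 0 (partial_sum S u (m + size w) - partial_sum S u m)) => h.
  by rewrite ger0_norm // => hw; exists (m + size w)%N, m.
by rewrite ltr0_norm // opprB => hw; exists m, (m + size w)%N.
Qed.

(* The discrepancy is attained to the right of every tile, so the oscillation of
   the partial sums from u and from the next tile agree, and so do their maxima. *)
Lemma max_partial_sum_next S u : tiles S u ->
  max_partial_sum S u = d u.1 + max_partial_sum S (next_tile S u).
Proof.
move=> Su; have [Sn _] := nextP Su; apply/eqP; rewrite eq_le; apply/andP; split.
  apply/ler_addgt0Pr => eta eta0.
  have [i [j ij]] := exists_discrepancy Sn eta0.
  have := @max_partial_sum_le S u i.+1 j.+1 eta Su; rewrite !partial_sumS.
  have := le_max_partial_sum i Sn.
  by move=> h1 h2; apply: le_trans (h2 _) _; lra.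
rewrite -lerBrDl; apply: ge_sup.
  by exists (partial_sum S (next_tile S u) 0); exists 0%N.
move=> _ [k _ <-]; rewrite lerBrDl -partial_sumS; exact: le_max_partial_sum.
Qed.

Variable lam : R.
Hypothesis lam_neq0 : lam != 0.
Hypothesis lam_int : forall a, exists m : int, lam * (t a)%:num + d a = m%:~R.

(** By [lam_int] the passage to the next tile changes this by an integer, so its image under [expi]
    depends on [S] alone. *)
Definition phase S u : R := - lam * u.2 + max_partial_sum S u.

Lemma phase_next S u : tiles S u ->
  exists m : int, phase S u = phase S (next_tile S u) + m%:~R.
Proof.
move=> Su; have [m hm] := lam_int u.1; have [_ nu] := nextP Su.
by exists m; rewrite /phase nu -hm max_partial_sum_next //; ring.
Qed.

Lemma expi_phase S u v : tiles S u -> tiles S v ->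
  expi (phase S u) = expi (phase S v).
Proof.
wlog uv : u v / u.2 <= v.2.
  move=> h Su Sv; have [uv|/ltW vu] := leP u.2 v.2; first exact: h.
  by symmetry; exact: h.
move=> Su Sv; have [k ->] := reach_next Su Sv uv.
elim: k => //= k ->; have [m ->] := phase_next (iter_nextP k Su).
by rewrite expiD expi_int mulr1.
Qed.

Lemma exists_tile S : exists u, tiles S u.
Proof.
have [cS _] := tiles_tiling S; have : [set: R] 0 by [].
by rewrite -cS => -[u Su _]; exists u.
Qed.

Definition phase_function S : R[i] := expi (phase S (projT1 (cid (exists_tile S)))).

Lemma phase_functionE S u : tiles S u -> phase_function S = expi (phase S u).
Proof. by apply: expi_phase; exact: projT2 (cid (exists_tile S)). Qed.

Lemma phase_function_action S g :
  phase_function (tiling_action zeta t g S) = expi (lam * g) * phase_function S.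
Proof.
have [u Su] := exists_tile S.
have [Su' _] := labels_action g 0 Su.
rewrite (phase_functionE Su) (phase_functionE Su') -expiD; congr expi.
rewrite /phase /max_partial_sum /=.
have -> : range (partial_sum (tiling_action zeta t g S) (u.1, u.2 - g)) =
    range (partial_sum S u).
  congr (_ @` _); apply/funext => k.
  by rewrite /partial_sum (labels_action g k Su).2.
ring.
Qed.

(** The pair [i], [j] found for [S] serves every nearby [S'], since the labels up to both indices
    agree. Both maxima then lie within [eta / 4] above the same partial sum, and the change of
    position costs at most another [eta / 4]. *)
Lemma phase_function_continuous :
  continuous (phase_function : tiling_space zeta t -> R[i]^o).
Proof.
move=> S; apply: (iffRL (@cvgrPdist_lt _ _ _ (nbhs S) (nbhs_filter S) _ _)) => eps eps0.
have [eta eta0 etaP] := expi_near1 eps0.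
have [u Su] := exists_tile S.
have eta20 : 0 < eta / 4 by rewrite divr_gt0.
have [i [j ij]] := exists_discrepancy Su eta20.
pose e := eta / (4 * (`|lam| + 1)).
have lam1 : 0 < `|lam| + 1 by rewrite ltr_wpDl.
have e0 : 0 < e by rewrite divr_gt0 // mulr_gt0.
apply: (@filterS _ (nbhs S) (nbhs_filter S) _ _ _ (labels_nbhs (i + j) Su e0)).
move=> S' [u' [Su' u'u lab]].
have psE k : (k <= (i + j).+1)%N -> partial_sum S' u' k = partial_sum S u k.
  move=> kl; rewrite /partial_sum; congr word_sum.
  move: lab; rewrite -(subnKC kl) !labelsD => /eqP.
  by rewrite eqseq_cat ?size_labels // => /andP[/eqP].
have psi : partial_sum S' u' i = partial_sum S u i by apply: psE; rewrite leqW ?leq_addr.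
have psj : partial_sum S' u' j = partial_sum S u j by apply: psE; rewrite leqW ?leq_addl.
rewrite (phase_functionE Su) (phase_functionE Su').
have -> : phase S' u' = phase S u + (phase S' u' - phase S u) by rewrite addrC subrK.
rewrite expiD -[X in `|X - _|]mulr1 -mulrBr normrM norm_expi mul1r distrC.
apply: etaP.
have h1 := le_max_partial_sum i Su; have h2 := max_partial_sum_le Su ij.
have h3 := le_max_partial_sum i Su'.
have := @max_partial_sum_le S' u' i j (eta / 4) Su'; rewrite psi psj => /(_ ij) h4.
rewrite psi in h3.
have h5 : `|lam * (u'.2 - u.2)| <= eta / 4.
  rewrite normrM; apply: (@le_trans _ _ (`|lam| * e)).
    by apply: ler_wpM2l => //; exact: ltW.
  have eE : e * (`|lam| + 1) = eta / 4 by rewrite /e; field; rewrite lt0r_neq0.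
  by rewrite -eE mulrDr mulr1 mulrC lerDl ltW.
move: h5; rewrite ler_norml => /andP[h5 h6].
by rewrite /phase ltr_norml; apply/andP; split; lra.
Qed.

Lemma eigenfunction_not_weakly_mixing S :
  ~ weakly_mixing (tiling_action zeta t).
Proof.
move=> /(_ phase_function phase_function_continuous)[].
  split; last by exists lam => S' g; exact: phase_function_action.
  by exists S; exact: expi_neq0.
(* Translation by [1 / (2 lam)] multiplies the function by -1, which a nonzero constant does not
   allow. *)
move=> c fc; have := phase_function_action S (2^-1 / lam).
rewrite !fc (mulrC lam) divfK // expi_half mulN1r => h.
have c0 : c != 0 by rewrite -(fc S) expi_neq0.
have : c + c == 0 by rewrite {1}h addNr.
by rewrite -mulr2n mulrn_eq0 /= (negbTE c0).
Qed.

End Eigenfunction.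

(** * The expanding case *)

Lemma word_sum_counts (R : realType) (d : 'I_2 -> R) w : word_sum d w =
  (count_mem ord0 w)%:R * d ord0 + (count_mem ord_max w)%:R * d ord_max.
Proof.
elim: w => [|a w IH]; first by rewrite word_sum_nil !mul0r addr0.
rewrite word_sum_cons IH /= !natrD.
by case: (ord2P a) => -> /=; lra.
Qed.

Section Mixing.
Variables (R : realType) (zeta : substitution 2) (t : 'I_2 -> {posnum R}).
Hypothesis zeta_prim : primitive zeta.
Variables (d : 'I_2 -> R) (theta : R).
Hypothesis d_eigen : forall a, word_sum d (zeta a) = theta * d a.
Hypothesis theta_gt1 : 1 < `|theta|.
Hypotheses (d0_gt0 : 0 < d ord0) (d1_lt0 : d ord_max < 0).
Hypothesis t_indep : forall p q : int,
  p%:~R * (t ord0)%:num + q%:~R * (t ord_max)%:num = 0 :> R -> p = 0 /\ q = 0.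
Implicit Types (S : tiling_space zeta t) (u : tile R 2).

Lemma supertile_gt0 k a : 0 < tlen t (subst_iter zeta k a).
Proof.
have [b [w ->]] := subst_iter_cons zeta k a.
by rewrite /tlen word_sum_cons ltr_pwDl //; exact: tlen_ge0.
Qed.

(* An integer relation between supertile lengths is one between the letter
   counts, hence also between the values of d, whose signs exclude it. *)
Lemma supertile_indep k (p q : int) :
  p%:~R * tlen t (subst_iter zeta k ord0) +
  q%:~R * tlen t (subst_iter zeta k ord_max) = 0 -> p = 0.
Proof.
have T0 := supertile_gt0 k ord0; have T1 := supertile_gt0 k ord_max.
move=> h; have dk a : word_sum d (subst_iter zeta k a) = theta ^+ k * d a.
  rewrite -iter_word1 (word_sum_iter_eigen d_eigen).
  by rewrite word_sum_cons word_sum_nil addr0.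
have := h; rewrite /tlen !word_sum_counts.
set z0 := count_mem _ _; set o0 := count_mem _ _.
set z1 := count_mem _ _; set o1 := count_mem _ _ => h'.
have [hz ho] : p * z0%:Z + q * z1%:Z = 0 /\ p * o0%:Z + q * o1%:Z = 0.
  by apply: t_indep; rewrite -h'; ring.
have hd : theta ^+ k * (p%:~R * d ord0 + q%:~R * d ord_max) = 0.
  have := dk ord0; have := dk ord_max; rewrite !word_sum_counts.
  rewrite -/z0 -/o0 -/z1 -/o1 => e1 e0.
  rewrite mulrDr !(mulrCA (theta ^+ k)) -e0 -e1.
  have -> : p%:~R * (z0%:R * d ord0 + o0%:R * d ord_max) +
      q%:~R * (z1%:R * d ord0 + o1%:R * d ord_max) =
      (p * z0%:Z + q * z1%:Z)%:~R * d ord0 + (p * o0%:Z + q * o1%:Z)%:~R * d ord_max.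
    by ring.
  by rewrite hz ho !mul0r addr0.
have thk : theta ^+ k != 0.
  rewrite expf_neq0 // -normr_gt0; exact: lt_trans theta_gt1.
move: hd => /eqP; rewrite mulf_eq0 (negbTE thk) /= => /eqP hd.
apply/eqP; rewrite -(intr_eq0 R); set P : R := p%:~R in h hd *.
set Q : R := q%:~R in h hd.
set x := tlen _ _ in T0 h; set y := tlen _ _ in T1 h.
have : P * (x * d ord_max - y * d ord0) = 0.
  have -> : P * (x * d ord_max - y * d ord0) =
    (P * x + Q * y) * d ord_max - (P * d ord0 + Q * d ord_max) * y by ring.
  by rewrite h hd !mul0r subrr.
move=> /eqP; rewrite mulf_eq0 => /orP[//|/eqP].
have h1 : 0 < x * - d ord_max by rewrite mulr_gt0 // oppr_gt0.
have h2 : 0 < y * d ord0 by rewrite mulr_gt0.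
lra.
Qed.

Lemma labels_factor S u A W B : tiles S u ->
  labels S u (size (A ++ W ++ B)) = A ++ W ++ B ->
  exists v, [/\ tiles S v, v.2 = u.2 + tlen t A & labels S v (size W) = W].
Proof.
move=> Su; rewrite !size_cat !labelsD => /eqP.
rewrite eqseq_cat ?size_labels // => /andP[/eqP e].
rewrite eqseq_cat ?size_labels // => /andP[/eqP e' _].
exists (iter (size A) (next_tile S) u); split => //; first exact: iter_nextP.
by rewrite iter_next_pos // e.
Qed.

(** A pattern forcing [U] lies in the supertile of 0 and one forcing [V] in that of 1. The words
    [0 w 1] of [length_dense], iterated [k] times and located in [S1], put the two patterns at any
    large prescribed distance up to [e2]. *)
Lemma mixing_forward (U V : set (tiling_space zeta t)) :
  open U -> open V -> (U !=set0)%classic -> (V !=set0)%classic ->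
  exists r : R, forall g, r <= g ->
    exists S, U S /\ V (tiling_action zeta t g S).
Proof.
move=> oU oV [S1 US1] [S2 VS2].
have [u1 [k1 [e1 [Su1 e10 UP]]]] := open_labels oU US1.
have [u2 [k2 [e2 [Su2 e20 VP]]]] := open_labels oV VS2.
have [K1 K1P] := lang_near zeta_prim (labels_lang k1 Su1).
have [K2 K2P] := lang_near zeta_prim (labels_lang k2 Su2).
set W1 := labels _ _ _ in UP K1P; set W2 := labels _ _ _ in VP K2P.
pose k := (K1 + K2)%N.
have /infixP[A1 [B1 E1]] := K1P k (leq_addr _ _) ord0.
have /infixP[A2 [B2 E2]] := K2P k (leq_addl _ _) ord_max.
have [r rP] := length_dense zeta_prim (supertile_gt0 k) (@supertile_indep k)
  (zeros_spread zeta_prim d_eigen theta_gt1 d0_gt0 d1_lt0) e20.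
(* Offsets of the patterns inside their supertiles and their reference positions in [S1] and
   [S2]. *)
pose c := tlen t A1 - tlen t A2 - u1.2 + u2.2.
exists (r - c) => g rg.
have [|w [Lw]] := rP (g + c); first by rewrite -lerBlDr.
have [m] := lang_occurs zeta_prim Su1 (lang_iter_word k Lw).
set x := iter m _ _; have Sx : tiles S1 x by exact: iter_nextP.
(* The letters were weighted by supertile lengths, so the sum is the length of the iterated word. *)
rewrite -[X in word_sum X]/(fun a =>
  word_sum (fun a => (t a)%:num) (subst_iter zeta k a)).
rewrite -word_sum_iter_word -/(tlen t _).
rewrite -cats1 -cat_cons iter_word_cat.
set Y := iter_word zeta k (ord0 :: w) => lab Yg.
have YE : exists Y', Y = A1 ++ W1 ++ Y'.
  by rewrite /Y iter_word_cons E1 -!catA; eexists.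
rewrite iter_word1 E2 in lab.
have [y1 [Sy1 y1p y1l]] : exists v,
    [/\ tiles S1 v, v.2 = x.2 + tlen t A1 & labels S1 v k1 = W1].
  have [Y' {}YE] := YE; rewrite -(size_labels S1 u1 k1) -/W1.
  apply: (@labels_factor _ _ A1 W1 (Y' ++ A2 ++ W2 ++ B2)) => //.
  by rewrite YE -!catA in lab.
have [y2 [Sy2 y2p y2l]] : exists v,
    [/\ tiles S1 v, v.2 = x.2 + tlen t (Y ++ A2) & labels S1 v k2 = W2].
  rewrite -(size_labels S2 u2 k2) -/W2.
  apply: (@labels_factor _ _ (Y ++ A2) W2 B2) => //.
  by rewrite (catA Y) in lab.
rewrite /tlen word_sum_cat -!/(tlen t _) in y2p.
(* Translated so that the first pattern starts exactly at [u1.2]; the whole error falls on the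
   second pattern. *)
exists (tiling_action zeta t (y1.2 - u1.2) S1); split.
  have [Sy1' y1l'] := labels_action (y1.2 - u1.2) k1 Sy1.
  apply: (UP _ _ Sy1'); last by rewrite y1l'.
  by rewrite /= subKr subrr normr0.
have [Sy2' y2l'] := labels_action (y1.2 - u1.2) k2 Sy2.
have [Sy2'' y2l''] := labels_action g k2 Sy2'.
apply: (VP _ _ Sy2''); last by rewrite y2l'' y2l'.
rewrite /= y2p y1p; set z := _ - u2.2.
have -> : z = tlen t Y - (g + c) by rewrite /z /c; ring.
exact: Yg.
Qed.

(** The two signs of [g] correspond to the two orders of [U] and [V] in [mixing_forward]. *)
Lemma mixing_of_expanding : topologically_mixing (tiling_action zeta t).
Proof.
move=> U V oU oV U0 V0.
have [r1 r1P] := mixing_forward oU oV U0 V0.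
have [r2 r2P] := mixing_forward oV oU V0 U0.
exists (1 + `|r1| + `|r2|); first by rewrite -addrA ltr_wpDr // addr_ge0.
move=> g; have [g0|g0] := leP 0 g => hg.
  have [|S [VS US]] := r2P g.
    by rewrite (ger0_norm g0) in hg; have := ler_norm r2; have : 0 <= `|r1| by []; lra.
  by exists (tiling_action zeta t g S); split => //; exists S.
have [|S [US VS]] := r1P (- g).
  by rewrite (ltr0_norm g0) in hg; have := ler_norm r1; have : 0 <= `|r2| by []; lra.
exists S; split => //; exists (tiling_action zeta t (- g) S) => //.
by apply: tiling_space_ext; rewrite /= Defs.shiftD addNr Defs.shift0.
Qed.

End Mixing.

(** * The second eigenvalue *)

Section SecondEigenvalue.
Variables (R : realType) (zeta : substitution 2).
Notation M := (subst_mx zeta).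

Lemma word_sum_subst (d : 'I_2 -> R) a :
  word_sum d (zeta a) = (M ord0 a)%:R * d ord0 + (M ord_max a)%:R * d ord_max.
Proof. by rewrite word_sum_counts !mxE. Qed.

Lemma complex_mx_mulE (v : 'rV[R[i]]_2) j :
  (v *m complex_mx R M) ord0 j =
  v ord0 ord0 * (M ord0 j)%:R + v ord0 ord_max * (M ord_max j)%:R.
Proof.
rewrite mxE big_ord_recl big_ord1 ![complex_mx _ _ _ _]mxE.
by congr (_ * _ + v ord0 _ * (M _ j)%:R); exact: val_inj.
Qed.

Lemma eigenvalue_char (theta : R[i]) : eigenvalue (complex_mx R M) theta ->
  (theta - (M ord0 ord0)%:R) * (theta - (M ord_max ord_max)%:R) =
  (M ord0 ord_max)%:R * (M ord_max ord0)%:R.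
Proof.
move=> /eigenvalueP[v vM v0].
have e0 := complex_mx_mulE v ord0; have e1 := complex_mx_mulE v ord_max.
rewrite vM ![(theta *: v) _ _]mxE in e0 e1.
set x := v ord0 ord0 in e0 e1; set y := v ord0 ord_max in e0 e1.
have h0 : (theta - (M ord0 ord0)%:R) * x = (M ord_max ord0)%:R * y.
  by rewrite mulrBl e0; ring.
have h1 : (theta - (M ord_max ord_max)%:R) * y = (M ord0 ord_max)%:R * x.
  by rewrite mulrBl e1; ring.
have [x0|xn] := eqVneq x 0; last first.
  by apply: (mulIf xn); rewrite mulrAC h0 mulrAC -mulrA h1; ring.
have yn : y != 0.
  apply/eqP => y0; move/eqP: v0; apply; apply/rowP => j.
  by rewrite mxE; case: (ord2P j) => ->.
by apply: (mulIf yn); rewrite -mulrA h1 mulrCA h0; ring.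
Qed.

Lemma eigenvector_eigenvalue (d : 'I_2 -> R) (r : R) :
  (forall a, word_sum d (zeta a) = r * d a) -> d ord0 != 0 ->
  eigenvalue (complex_mx R M) r%:C.
Proof.
move=> dr d0; apply/eigenvalueP; exists (\row_j (d j)%:C).
  apply/rowP => j; rewrite complex_mx_mulE !mxE -rmorphM -dr word_sum_subst !mxE.
  by rewrite rmorphD !rmorphM !rmorph_nat mulrC [X in _ + X]mulrC.
apply/eqP => /rowP/(_ ord0); rewrite !mxE => /eqP.
by rewrite eq_complex /= eqxx andbT (negbTE d0).
Qed.

Hypothesis zeta_prim : primitive zeta.

(** With two letters, a letter [i] missing from [zeta j] makes [zeta j], and then every iterate of
    [j], a power of [j]. *)
Lemma primitive_offdiag i j : i != j -> (0 < M i j)%N.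
Proof.
move=> ij; rewrite mxE -has_count has_pred1; apply: contraT => nij.
have zj : all (pred1 j) (zeta j).
  apply/allP => x xz /=; apply: contraT => xj; rewrite -(negbTE nij).
  suff -> : i = x by [].
  by move: ij xj; case: (ord2P i) => ->; case: (ord2P j) => ->; case: (ord2P x) => ->.
have all_iter k : all (pred1 j) (subst_iter zeta k j).
  elim: k => [|k IH]; first by rewrite /= eqxx.
  rewrite subst_iterSr; elim: (zeta j) zj => [|a w IHw] /=.
    by rewrite iter_word_nil.
  by move=> /andP[/eqP-> wj]; rewrite iter_word_cons all_cat IH IHw.
have [K /(_ K (leqnn K) i j)] := primitive_mem zeta_prim.
by move=> /(allP (all_iter K)) /=; rewrite (negbTE ij).
Qed.

(** Positive off-diagonal entries make the discriminant positive, so the characteristic roots are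
    real and distinct. Dominance identifies [theta1] with the larger root [rp], leaving [rm] for
    [theta2]. *)
Lemma second_eigenvalue (theta1 theta2 : R[i]) :
  perron_frobenius_eigenvalue M theta1 -> eigenvalue (complex_mx R M) theta2 ->
  theta2 != theta1 ->
  exists (r : R) (d : 'I_2 -> R), [/\ theta2 = r%:C,
    forall a, word_sum d (zeta a) = r * d a, 0 < d ord0 & d ord_max < 0].
Proof.
move=> [ev1 th1_ge0 th1_max] ev2 th21.
pose a : R := (M ord0 ord0)%:R; pose e : R := (M ord_max ord_max)%:R.
pose b : R := (M ord0 ord_max)%:R; pose c : R := (M ord_max ord0)%:R.
have b0 : 0 < b by rewrite ltr0n primitive_offdiag.
have c0 : 0 < c by rewrite ltr0n primitive_offdiag.
have bc0 : 0 < b * c by exact: mulr_gt0.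
pose s := Num.sqrt ((a - e) ^+ 2 + 4 * (b * c)).
have disc0 : 0 < (a - e) ^+ 2 + 4 * (b * c).
  by apply: ltr_wpDl; [exact: sqr_ge0 | rewrite mulr_gt0].
have s0 : 0 < s by rewrite sqrtr_gt0.
have s2 : s ^+ 2 = (a - e) ^+ 2 + 4 * (b * c) by rewrite sqr_sqrtr // ltW.
pose rp := (a + e + s) / 2; pose rm := (a + e - s) / 2.
have roots th : eigenvalue (complex_mx R M) th -> th = rp%:C \/ th = rm%:C.
  move=> /eigenvalue_char.
  have natC k : k%:R = (k%:R : R)%:C :> R[i] by rewrite rmorph_nat.
  rewrite !natC -/a -/b -/c -/e => h.
  have rD : rp + rm = a + e by rewrite /rp /rm; field.
  have rM : rp * rm = a * e - b * c.
    have -> : rp * rm = ((a + e) ^+ 2 - s ^+ 2) / 4 by rewrite /rp /rm; field.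
    by rewrite s2; field.
  have : (th - rp%:C) * (th - rm%:C) = 0.
    have CD (x y : R) : (x + y)%:C = x%:C + y%:C by rewrite rmorphD.
    have CB (x y : R) : (x - y)%:C = x%:C - y%:C by rewrite rmorphB.
    have CM (x y : R) : (x * y)%:C = x%:C * y%:C by rewrite rmorphM.
    have -> : (th - rp%:C) * (th - rm%:C) =
        th * th - (rp + rm)%:C * th + (rp * rm)%:C.
      by rewrite CD CM; move: rp%:C rm%:C => x y; ring.
    rewrite rD rM CD CB !CM -h.
    by move: a%:C e%:C => x y; ring.
  by move=> /eqP; rewrite mulf_eq0 !subr_eq0 => /orP[]/eqP ->; [left|right].
(* For a characteristic root [r], the vector [(c, r - a)] is a left eigenvector. *)
pose d r : 'I_2 -> R := fun j => if j == ord0 then c else r - a.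
have dE r : (r - a) * (r - e) = b * c -> forall j, word_sum (d r) (zeta j) = r * d r j.
  move=> h j; rewrite word_sum_subst /d /=; case: (ord2P j) => -> /=.
    by rewrite -/a -/c; ring.
  by rewrite -/b -/e -h; ring.
have rpE : (rp - a) * (rp - e) = b * c.
  have -> : (rp - a) * (rp - e) = (s ^+ 2 - (a - e) ^+ 2) / 4 by rewrite /rp; field.
  by rewrite s2; field.
have rmE : (rm - a) * (rm - e) = b * c.
  have -> : (rm - a) * (rm - e) = (s ^+ 2 - (a - e) ^+ 2) / 4 by rewrite /rm; field.
  by rewrite s2; field.
have th1E : theta1 = rp%:C.
  have [//|th1E] := roots _ ev1.
  have evp : eigenvalue (complex_mx R M) rp%:C.
    by apply: (eigenvector_eigenvalue (dE _ rpE)); rewrite /d /= lt0r_neq0.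
  have := th1_max _ evp; rewrite th1E normc_real lecR leNgt => /negP[].
  by apply: lt_le_trans (ler_norm rp); rewrite /rp /rm -subr_gt0; clear -s0; lra.
have th2E : theta2 = rm%:C.
  by have [th2E|//] := roots _ ev2; move: th21; rewrite th1E th2E eqxx.
exists rm, (d rm); split => //; first exact: dE.
rewrite /d /= ltNge; apply/negP => h.
(* The factors [rm - a] and [rm - e] have positive product [b * c] and negative sum [- s], so both
   are negative. *)
have neg : rm - a + (rm - e) < 0 by rewrite /rm; clear -s0; lra.
have h' : rm - e < 0 by clear -neg h; lra.
by have := mulr_ge0_le0 h (ltW h'); rewrite rmE leNgt bc0.
Qed.

End SecondEigenvalue.

Theorem corollary1p3 (R : realType) (zeta : substitution 2)
    (t : 'I_2 -> {posnum R}) (theta1 theta2 : R[i]) :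
  primitive zeta -> aperiodic zeta ->
  perron_frobenius_eigenvalue (subst_mx zeta) theta1 ->
  eigenvalue (complex_mx R (subst_mx zeta)) theta2 ->
  theta2 != theta1 ->
  `|theta2| != 1 ->
  topologically_mixing (tiling_action zeta t) <->
  weakly_mixing (tiling_action zeta t).
Proof.
move=> zeta_prim _ pf ev2 th21 th2n1; split; first exact: mixing_weakly_mixing.
(* Mixing is vacuous on an empty space; otherwise a tiling [S] serves to contradict weak mixing. *)
move=> wm; have [[S _]|noS] := pselect (exists S : tiling_space zeta t, True); last first.
  by move=> U V _ _ [S _]; case: noS; exists S.
have [r [d [th2E d_eigen d0 d1]]] := second_eigenvalue zeta_prim pf ev2 th21.
have t0 : 0 < (t ord0)%:num by [].
have t1 : 0 < (t ord_max)%:num by [].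
move: th2n1; rewrite th2E normc_real.
have [r1 _|r1 _|->] := ltgtP `|r| 1; last by rewrite eqxx.
- have tmin : (t ord0)%:num * d ord_max - (t ord_max)%:num * d ord0 < 0.
    have : 0 < (t ord0)%:num * - d ord_max by rewrite mulr_gt0 // oppr_gt0.
    have : 0 < (t ord_max)%:num * d ord0 by rewrite mulr_gt0.
    lra.
  set D := _ - _ in tmin; have D0 : D != 0 by rewrite lt_eqF.
  (* With [lam := d ord_max / D], this solves the system in which [lam * t + beta * d] equals 1 at
     the letter 0 and 0 at the letter 1. Its determinant [D] is nonzero because the entries of [d]
     have opposite signs. *)
  pose beta := - (t ord_max)%:num / D.
  exfalso; apply: (@eigenfunction_not_weakly_mixing R 2 zeta t zeta_prim
    (fun a => beta * d a) _ (d ord_max / D) _ _ S wm).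
  + have [C CP] := word_sum_lang_bounded d_eigen r1; exists (`|beta| * C) => w Lw.
    rewrite /word_sum -mulr_sumr normrM; apply: ler_wpM2l => //; exact: CP.
  + by rewrite mulf_neq0 ?invr_neq0 // lt_eqF.
  + move=> a; case: (ord2P a) => ->.
      by exists 1; rewrite /beta /D; field.
    by exists 0; rewrite /beta /D; field.
- have [indep|dep] := pselect (forall p q : int,
    p%:~R * (t ord0)%:num + q%:~R * (t ord_max)%:num = 0 :> R -> p = 0 /\ q = 0).
    exact: mixing_of_expanding zeta_prim _ _ d_eigen r1 d0 d1 indep.
  exfalso; apply: dep => p q pq; have t1n := lt0r_neq0 t1.
  have [p0|p0] := eqVneq p 0.
    split=> //; apply/eqP; rewrite -(intr_eq0 R).
    by move: pq; rewrite p0 mul0r add0r => /eqP; rewrite mulf_eq0 (negbTE t1n) orbF.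
  (* For this [lam] the relation [pq] turns the products with the two tile lengths into the integers
     [- q] and [p]. *)
  exfalso; apply: (@eigenfunction_not_weakly_mixing R 2 zeta t zeta_prim (fun=> 0) _
    (p%:~R / (t ord_max)%:num) _ _ S wm).
  + by exists 0 => w _; rewrite /word_sum big1_eq normr0.
  + by rewrite mulf_neq0 ?invr_neq0 // intr_eq0.
  + move=> a; case: (ord2P a) => ->; last by exists p; rewrite addr0 divfK.
    exists (- q); rewrite addr0 mulrAC rmorphN; apply: (mulIf t1n).
    by rewrite divfK // mulNr; lra.
Qed.
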